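(* Let $\mathbb{A}$ be an acyclic cluster algebra over $\mathbb{C}$ with trivial coefficients of even rank $n=2k$, given by a seed $(x_1,\ldots,x_n,B)$ where $B=(b_{ij})$ is an invertible skew-symmetric $n\times n$ integer matrix satisfying $b_{ij}>0$ whenever $i<j$. Write $B^{-1}=((b^{-1})_{ij})$ and suppose that for every $i\in[1,n]$ $$\sum_{j=1}^n (b^{-1})_{ij}\bigl(\max(b_{ij},0)+\min(b_{ij},0)\bigr)\neq 0 .$$ Then the affine variety $X$ defined by $\mathbb{A}=\mathbb{C}[X]$ is smooth.
   Context: Cluster algebra. Let $\mathfrak{F}=\mathbb{C}(x_1,\ldots,x_n)$. For $1\le i\le n$ put $P_i=\prod_{k=1}^n x_k^{\max(b_{ik},0)}+\prod_{k=1}^n x_k^{-\min(b_{ik},0)}$ and $y_i=x_i^{-1}P_i$. Mutation of the seed $(x_1,\ldots,x_n,B)$ in direction $k$ replaces $x_k$ by $y_k$ and $B$ by $B'$ with $b'_{ij}=-b_{ij}$ if $i=k$ or $j=k$, and $b'_{ij}=b_{ij}+\frac{|b_{ik}|b_{kj}+b_{ik}|b_{kj}|}{2}$ otherwise. The cluster algebra $\mathbb{A}$ is the $\mathbb{C}$-subalgebra of $\mathfrak{F}$ generated by the elements of all clusters of seeds obtained by iterated mutation (all $n$ directions are mutable; ''trivial coefficients'' means there are no frozen variables). Such an $\mathbb{A}$ is a finitely generated domain over $\mathbb{C}$, and $X$ is the affine variety with coordinate ring $\mathbb{A}$. *)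

(* Defs.v *)
From HB Require Import structures.
From mathcomp Require Import all_boot all_order all_algebra.
From mathcomp Require Import fraction boolp reals complex mpoly.

Set Implicit Arguments.
Unset Strict Implicit.
Unset Printing Implicit Defensive.

Import Order.TTheory GRing.Theory Num.Theory.

Local Open Scope ring_scope.

(* Geometry of the affine variety X with coordinate ring A = K[X], a domain over
   an algebraically closed field K.  A closed point of X is identified with the
   evaluation morphism A -> K at that point. *)

Section AffineVariety.
Variables (K : fieldType) (A : comAlgType K).

Definition alg_independent (d : nat) (z : 'I_d -> A) : Prop :=
  forall P : {mpoly K[d]}, mmap (in_alg A) z P = 0 -> P = 0.

(* dim X is the transcendence degree of the function field of X, i.e. the
   largest number of algebraically independent elements of the domain A. *)
Definition variety_dim (d : nat) : Prop :=
  (exists z : 'I_d -> A, alg_independent z) /\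
  (forall (e : nat) (z : 'I_e -> A), alg_independent z -> (e <= d)%N).

Definition point : Type := {lrmorphism A -> K | *%R}.

Definition in_max_ideal (p : point) (a : A) : Prop := p a = 0.

Definition in_max_ideal_sq (p : point) (a : A) : Prop :=
  exists (m : nat) (u v : 'I_m -> A),
    [/\ forall i, in_max_ideal p (u i),
        forall i, in_max_ideal p (v i)
      & a = \sum_(i < m) u i * v i].

(* The Zariski cotangent space m_p / m_p^2 has dimension d over K: the classes
   of some e_0, ..., e_(d-1) in m_p form a basis of it. *)
Definition cotangent_dim (p : point) (d : nat) : Prop :=
  exists e : 'I_d -> A,
    [/\ forall i, in_max_ideal p (e i),
        forall a, in_max_ideal p a ->
          exists c : 'I_d -> K, in_max_ideal_sq p (a - \sum_(i < d) c i *: e i)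
      & forall c : 'I_d -> K,
          in_max_ideal_sq p (\sum_(i < d) c i *: e i) -> forall i, c i = 0].

Definition smooth : Prop :=
  exists2 d : nat, variety_dim d & forall p : point, cotangent_dim p d.

End AffineVariety.

Section RationalFunctions.
Variables (K : fieldType) (n : nat).

Definition ratfun : Type := {fraction {mpoly K[n]}}.

HB.instance Definition _ := GRing.Field.on ratfun.

Definition ratfun_const (c : K) : ratfun := tofrac (mpolyC n c).

Definition ratfun_var (i : 'I_n) : ratfun := tofrac (mpolyX K (mnm1 i)).

Definition ratfun_scale (c : K) (f : ratfun) : ratfun := ratfun_const c * f.

Fact ratfun_scaleA (a b : K) (f : ratfun) :
  ratfun_scale a (ratfun_scale b f) = ratfun_scale (a * b) f.
Proof. by rewrite /ratfun_scale /ratfun_const !rmorphM mulrA. Qed.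

Fact ratfun_scale1 : left_id 1 ratfun_scale.
Proof. by move=> f; rewrite /ratfun_scale /ratfun_const !rmorph1 mul1r. Qed.

Fact ratfun_scaleDr : right_distributive ratfun_scale +%R.
Proof. by move=> c f g; rewrite /ratfun_scale mulrDr. Qed.

Fact ratfun_scaleDl (f : ratfun) : {morph ratfun_scale^~ f : a b / a + b}.
Proof. by move=> a b; rewrite /ratfun_scale /ratfun_const !rmorphD mulrDl. Qed.

HB.instance Definition _ := GRing.Zmodule_isLmodule.Build K ratfun
  ratfun_scaleA ratfun_scale1 ratfun_scaleDr ratfun_scaleDl.

Fact ratfun_scaleAl (c : K) (f g : ratfun) : c *: (f * g) = (c *: f) * g.
Proof. exact: mulrA. Qed.

HB.instance Definition _ :=
  GRing.Lmodule_isLalgebra.Build K ratfun ratfun_scaleAl.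

HB.instance Definition _ := GRing.Lalgebra_isComAlgebra.Build K ratfun.

End RationalFunctions.

Definition skew_symmetric (n : nat) (B : 'M[int]_n) : Prop := B^T = - B.

(* Integer exchange matrices are inverted over the rationals: in 'M[int]_n only
   the matrices of determinant 1 or -1 are units. *)
Definition ratmx (n : nat) (B : 'M[int]_n) : 'M[rat]_n := map_mx intr B.

Section Cluster.
Variables (K : fieldType) (n : nat).

Record seed := Seed { cluster : 'I_n -> ratfun K n; exchange : 'M[int]_n }.

Definition exchange_poly (s : seed) (i : 'I_n) : ratfun K n :=
  \prod_(k < n) cluster s k ^ Num.max (exchange s i k) 0
  + \prod_(k < n) cluster s k ^ (- Num.min (exchange s i k) 0).

(* The division by 2 below is exact. *)
Definition mutate_mx (B : 'M[int]_n) (k : 'I_n) : 'M[int]_n :=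
  \matrix_(i, j)
    if (i == k) || (j == k) then - B i j
    else B i j + ((`|B i k| * B k j + B i k * `|B k j|) %/ 2)%Z.

Definition mutate (s : seed) (k : 'I_n) : seed :=
  Seed (fun i => if i == k then (cluster s k)^-1 * exchange_poly s k
                 else cluster s i)
       (mutate_mx (exchange s) k).

Definition initial_seed (B : 'M[int]_n) : seed := Seed (@ratfun_var K n) B.

Definition reached_seed (B : 'M[int]_n) (w : seq 'I_n) : seed :=
  foldl mutate (initial_seed B) w.

Definition cluster_variable (B : 'M[int]_n) (f : ratfun K n) : Prop :=
  exists (w : seq 'I_n) (i : 'I_n), f = cluster (reached_seed B w) i.

Definition in_cluster_algebra (B : 'M[int]_n) : {pred ratfun K n} :=
  fun f => `[< forall S : {pred ratfun K n}, subalg_closed S ->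
    (forall g, cluster_variable B g -> g \in S) -> f \in S >].

Fact in_cluster_algebra_closed (B : 'M[int]_n) :
  GRing.subsemialg_closed (in_cluster_algebra B).
Proof.
apply: GRing.subalg_closed_semi; split.
- by apply/asboolP=> S [].
- move=> c f g /asboolP Hf /asboolP Hg; apply/asboolP=> S HS HV.
  by case: (HS) => _ HL _; apply: HL; [exact: Hf | exact: Hg].
- move=> f g /asboolP Hf /asboolP Hg; apply/asboolP=> S HS HV.
  by case: (HS) => _ _ HM; apply: HM; [exact: Hf | exact: Hg].
Qed.

HB.instance Definition _ (B : 'M[int]_n) :=
  GRing.isSubalgClosed.Build K (ratfun K n) (in_cluster_algebra B)
    (in_cluster_algebra_closed B).

Record cluster_algebra (B : 'M[int]_n) := ClusterAlgebra {
  cluster_algebra_val : ratfun K n;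
  cluster_algebra_valP : cluster_algebra_val \in in_cluster_algebra B }.

HB.instance Definition _ (B : 'M[int]_n) :=
  [isSub for @cluster_algebra_val B].
HB.instance Definition _ (B : 'M[int]_n) :=
  [Choice of cluster_algebra B by <:].
HB.instance Definition _ (B : 'M[int]_n) :=
  [SubChoice_isSubComNzRing of cluster_algebra B by <:].
HB.instance Definition _ (B : 'M[int]_n) :=
  [SubZmodule_isSubLmodule of cluster_algebra B by <:].
HB.instance Definition _ (B : 'M[int]_n) :=
  [SubNzRing_SubLmodule_isSubLalgebra of cluster_algebra B by <:].
HB.instance Definition _ (B : 'M[int]_n) :=
  [SubLalgebra_isSubAlgebra of cluster_algebra B by <:].

End Cluster.

(* The quiver of B has an arrow i -> j when b_ij > 0. *)
Definition acyclic_mx (n : nat) (B : 'M[int]_n) : Prop :=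
  forall c : seq 'I_n, c != [::] -> ~~ cycle (fun i j => 0 < B i j) c.

Definition acyclic_cluster_algebra (K : fieldType) (n : nat) (B : 'M[int]_n) :
    Prop :=
  exists w : seq 'I_n, acyclic_mx (exchange (reached_seed K B w)).

(* Main.v *)
Require Import Defs.
From HB Require Import structures.
From mathcomp Require Import all_boot all_order all_algebra.
From mathcomp Require Import fraction boolp reals complex mpoly.
From mathcomp Require Import zify ring.

Set Implicit Arguments.
Unset Strict Implicit.
Unset Printing Implicit Defensive.

Import Order.TTheory GRing.Theory Num.Theory.

Local Open Scope ring_scope.
Local Open Scope complex_scope.

(** Write [A] for the cluster algebra, [x_i] for the initial variables and [y_i] for
    the variable exchanged with [x_i], so that [x_i * y_i = P_i], where [P_i] is a
    sum of two monomials in the other initial variables.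

    The algebraic input is the Laurent phenomenon in a strong form: an element of
    [A] is a Laurent polynomial in the initial cluster and also in each of the [n]
    adjacent clusters ([cluster_algebra_upper_bound]). As observed by Berenstein,
    Fomin and Zelevinsky, it is enough to see that this property passes from a
    mutated seed back to the seed ([upper_bound_mutate]), and this involves only two
    directions [i] and [k] ([laurent_exchange]). There one shows that an element
    which is Laurent in a cluster [z], and in the cluster obtained by exchanging [k]
    and then [i], is Laurent in the cluster obtained by exchanging [i] alone: its
    denominator divides a power of the exchange binomial of direction [i] and also a
    monomial in the two new variables, and these are coprime. Coprimality is proved
    with integer gradings instead of unique factorization ([homog_coprime]): the
    binomial is homogeneous while each new variable has a single monomial as top
    component. When [b_ik] is zero, the grading exists because rows [i] and [k] of
    the exchange matrix are not parallel; this is where invertibility of the matrix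
    is used, and mutation preserves it ([mutate_nondeg]).

    The geometric input is that [b_ij > 0] for [i < j] forces at most one [x_i] to
    vanish at a point of the variety ([vanish_at_most_one]). Near such a point the
    other [x_j] are invertible, and an element of [A] is then a polynomial in [x_i]
    and [y_i] with coefficients Laurent in the other [x_j] ([two_tori]). So [A] is
    locally the coordinate ring of the hypersurface [x_i * y_i = P_i] in these
    variables, with no further relation ([exch_eq_dvd]). Choose [k] other than [i],
    which is possible because [n] is even, the case without variables being trivial:
    the variable [x_k] occurs in exactly one monomial of [P_i], which does not vanish
    at the point, so the derivative of the equation along [x_k] is nonzero: the
    differentials of [y_i] and of the [x_j] with [j] different from [k] form a basis
    of the cotangent space ([cotangent_chart]). They generate by the Leibniz rule
    ([cot_span]), and they are independent because each of them is detected by a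
    first-order arc on the hypersurface ([arc_deriv_indep]).

    Finally the dimension of the variety is also [n]: the [x_i] are algebraically
    independent, and more than [n] rational functions in them are algebraically
    dependent by a count of monomials ([alg_dependent]). *)

(** * Gradings of polynomial rings by integer weights *)

Section Weights.
Variables (K : fieldType) (n : nat).
Implicit Types (l : 'I_n -> int) (m u : 'X_{1..n}) (p q : {mpoly K[n]}).

Definition wt l m : int := \sum_i l i *+ m i.

Lemma wtD l m u : wt l (m + u)%MM = wt l m + wt l u.
Proof.
by rewrite -big_split /=; apply: eq_bigr => i _; rewrite mnmDE mulrnDr.
Qed.

Lemma wt0 l : wt l 0%MM = 0.
Proof. by rewrite /wt big1 // => i _; rewrite mnm0E. Qed.

Lemma wtU l i : wt l U_(i)%MM = l i.
Proof.
rewrite /wt (bigD1 i) //= mnm1E eqxx mulr1n big1 ?addr0 // => j /negPf nji.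
by rewrite mnm1E eq_sym nji.
Qed.

Definition wt_below l (d : int) p : Prop :=
  forall m, m \in msupp p -> wt l m <= d.

Lemma wt_belowW l d d' p : d <= d' -> wt_below l d p -> wt_below l d' p.
Proof. by move=> dd' lep m /lep; move=> /le_trans; apply. Qed.

Lemma wt_below0 l d : wt_below l d 0.
Proof. by move=> m; rewrite msupp0. Qed.

Lemma wt_belowD l d p q :
  wt_below l d p -> wt_below l d q -> wt_below l d (p + q).
Proof.
by move=> lp lq m /msuppD_le; rewrite mem_cat => /orP[/lp|/lq].
Qed.

Lemma wt_belowM l d e p q :
  wt_below l d p -> wt_below l e q -> wt_below l (d + e) (p * q).
Proof.
move=> lp lq m /msuppM_le /allpairsP[[m1 m2] /= [/lp h1 /lq h2 ->]].
by rewrite wtD lerD.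
Qed.

Lemma wt_belowX l m : wt_below l (wt l m) 'X_[m].
Proof. by move=> u /mem_msuppXP <-. Qed.

Lemma wt_belowC l c : wt_below l 0 c%:MP.
Proof.
by move=> m; rewrite msuppC; case: ifP => // _; rewrite inE => /eqP->; rewrite wt0.
Qed.

Lemma wt_below_exists l p : exists d, wt_below l d p.
Proof.
exists (\sum_(m <- msupp p) `|wt l m|) => m mp.
rewrite (big_rem m) //= (le_trans (ler_norm _)) // lerDl.
by apply: sumr_ge0 => u _; rewrite normr_ge0.
Qed.

Definition hpart l (d : int) p : {mpoly K[n]} :=
  \sum_(m <- msupp p | wt l m == d) p@_m *: 'X_[m].

Lemma mcoeff_hpart l d p m :
  (hpart l d p)@_m = if wt l m == d then p@_m else 0.
Proof.
rewrite /hpart -big_filter raddf_sum /=.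
have [/= mp|/= mp] := boolP (m \in [seq i <- msupp p | wt l i == d]).
  rewrite (bigD1_seq m) ?filter_uniq ?msupp_uniq //= mcoeffZ mcoeffX eqxx mulr1.
  rewrite big1 ?addr0 => [|u /negPf um]; last by rewrite mcoeffZ mcoeffX um mulr0.
  by move: mp; rewrite mem_filter => /andP[->].
rewrite big1_seq => [|u /andP[_ up]].
  move: mp; rewrite mem_filter negb_and => /orP[/negPf->//|].
  by rewrite -mcoeff_eq0 => /eqP ->; case: ifP.
rewrite mcoeffZ mcoeffX; case: eqP => [um|]; last by rewrite mulr0.
by rewrite -um up in mp.
Qed.

Lemma hpartD l d p q : hpart l d (p + q) = hpart l d p + hpart l d q.
Proof.
apply/mpolyP => m; rewrite mcoeffD !mcoeff_hpart mcoeffD.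
by case: eqP => //; rewrite addr0.
Qed.

Lemma hpart0 l d : hpart l d 0 = 0.
Proof. by rewrite /hpart msupp0 big_nil. Qed.

Lemma hpart_mono l d c m :
  hpart l d (c *: 'X_[m]) = if wt l m == d then c *: 'X_[m] else 0.
Proof.
apply/mpolyP => u; rewrite mcoeff_hpart (fun_if (mcoeff u)) mcoeff0 mcoeffZ mcoeffX.
by case: (m =P u) => [->//|_]; rewrite mulr0 !if_same.
Qed.

Lemma hpartXM l d m p :
  hpart l (wt l m + d) ('X_[m] * p) = 'X_[m] * hpart l d p.
Proof.
elim/mpolyind: p => [|c u p _ _ IH]; first by rewrite !(hpart0, mulr0).
rewrite mulrDr !hpartD IH mulrDr; congr (_ + _).
rewrite -scalerAr -mpolyXD !hpart_mono wtD (inj_eq (addrI _)).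
by case: eqP; rewrite ?mulr0 // -scalerAr -mpolyXD.
Qed.

Definition wt_homog l (c : int) p : Prop := forall m, m \in msupp p -> wt l m = c.

Lemma hpart_homogM l c d p q :
  wt_homog l c p -> hpart l (c + d) (p * q) = p * hpart l d q.
Proof.
move=> hp; rewrite [in LHS](mpolyE p) [in RHS](mpolyE p) !mulr_suml.
rewrite (big_morph _ (hpartD l (c + d)) (hpart0 l (c + d))).
apply: eq_big_seq => m /hp mc.
rewrite -!mul_mpolyC -!mulrA !mul_mpolyC -mc -hpartXM.
apply/mpolyP => u; rewrite mcoeff_hpart !mcoeffZ mcoeff_hpart.
by case: eqP => //; rewrite mulr0.
Qed.

Lemma hpart_below l d e p : wt_below l e p -> e < d -> hpart l d p = 0.
Proof.
move=> lp ed; rewrite /hpart big1_seq // => m /andP[/eqP wm /lp].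
by rewrite wm leNgt ed.
Qed.

Lemma msupp_hpartB l d p :
  perm_eq (msupp (p - hpart l d p)) [seq m <- msupp p | wt l m != d].
Proof.
apply: uniq_perm; rewrite ?filter_uniq ?msupp_uniq // => m.
rewrite mem_filter !mcoeff_msupp mcoeffB mcoeff_hpart.
by case: (wt l m == d); rewrite ?subrr ?eqxx ?subr0.
Qed.

Lemma msupp_top l p : p != 0 -> exists2 m, m \in msupp p & wt_below l (wt l m) p.
Proof.
rewrite -msupp_eq0; rewrite /wt_below.
elim: (msupp p) => // m s IH _.
have [->|/IH[u us lu]] := eqVneq s [::].
  by exists m => [|u]; rewrite inE // => /eqP->.
have [mu|um] := lerP (wt l m) (wt l u).
  by exists u => [|v]; rewrite inE ?us ?orbT // => /orP[/eqP->//|/lu].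
exists m => [|v]; rewrite inE ?eqxx // => /orP[/eqP->//|/lu].
by move=> /le_trans; apply; apply: ltW.
Qed.

(** A coprimality criterion that avoids unique factorization. Comparing top
    components shows that [P] divides the top component of [g] up to a monomial,
    because the top component of ['X_[m] + w] is a monomial; this component can
    then be removed from [g]. *)
Lemma homog_coprime l c m P w g h :
    wt_homog l c P -> wt_below l (wt l m - 1) w -> ('X_[m] + w) * g = P * h ->
  exists u h', 'X_[u] * g = P * h'.
Proof.
move=> hP lw.
have [k] := ubnP (size (msupp g)); elim: k g h => // k IH g h gk E.
have [->|g0] := eqVneq g 0; first by exists 0%MM, 0; rewrite !mulr0.
have [t tg lg] := msupp_top l g0.
set d := wt l t in lg.
pose gt := hpart l d g; pose ht := hpart l (wt l m + d - c) h.
have top : 'X_[m] * gt = P * ht.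
  have := congr1 (hpart l (wt l m + d)) E.
  rewrite [(_ + w) * _]mulrDl !hpartD hpartXM.
  rewrite (@hpart_below l _ (wt l m - 1 + d) (w * g)) ?addr0; first last.
  - by rewrite ltrD2r ltrBlDr ltrDl.
  - exact: wt_belowM.
  by move=> ->; rewrite -(hpart_homogM _ _ hP) [c + _]addrC subrK.
have [||u [h' E']] := IH ('X_[m] * (g - gt)) ('X_[m] * h - ('X_[m] + w) * ht).
- rewrite mulrC (perm_size (msuppMX _ _)) size_map (perm_size (msupp_hpartB _ _ _)).
  rewrite size_filter -ltnS (leq_trans _ gk) // !ltnS -(count_predC [pred x | wt l x == d]).
  by rewrite -[X in (X < _)%N]add0n ltn_add2r -has_count; apply/hasP; exists t => /=.
- transitivity ('X_[m] * (('X_[m] + w) * g) - ('X_[m] + w) * ('X_[m] * gt)).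
    by ring.
  by rewrite E top; ring.
exists (u + m)%MM, (h' + 'X_[u] * ht).
transitivity ('X_[u] * ('X_[m] * (g - gt)) + 'X_[u] * ('X_[m] * gt)).
  by rewrite mpolyXD; ring.
by rewrite E' top; ring.
Qed.

Definition ind_wt (i j : 'I_n) : int := (j == i)%:R.

Lemma wt_ind i m : wt (ind_wt i) m = (m i)%:R.
Proof.
rewrite /wt (bigD1 i) //= /ind_wt eqxx big1 ?addr0 // => j /negPf ->.
by rewrite mul0rn.
Qed.

Lemma mpoly_divX i p : exists q, p = hpart (ind_wt i) 0 p + 'X_i * q.
Proof.
elim/mpolyind: p => [|c m p _ _ [q IH]]; first by exists 0; rewrite hpart0 mulr0 addr0.
rewrite hpartD hpart_mono wt_ind pnatr_eq0; case: eqP => [_|/eqP mi].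
  by exists q; rewrite -addrA -IH.
exists (c *: 'X_[m - U_(i)] + q).
rewrite mulrDr -scalerAr -mpolyXD addmC submK ?lep1mP //.
by rewrite add0r addrCA -IH.
Qed.

(** Compare the components free of the [i]-th variable: the one of the left-hand
    side is zero, and multiplication by [P] preserves the grading. *)
Lemma mpolyX_coprime i N P c h :
    P != 0 -> (forall m, m \in msupp P -> m i = 0%N) ->
    ('X_i : {mpoly K[n]}) ^+ N * c = P * h ->
  exists h', h = ('X_i : {mpoly K[n]}) ^+ N * h'.
Proof.
move=> P0 Pi; elim: N c h => [|N IH] c h; first by exists h; rewrite mul1r.
rewrite exprS -mulrA => E.
have hP : wt_homog (ind_wt i) 0 P by move=> m /Pi mi; rewrite wt_ind mi.
have E0 : P * hpart (ind_wt i) 0 h = 0.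
  rewrite -(hpart_homogM _ _ hP) -E addr0.
  have -> : 0 = wt (ind_wt i) U_(i)%MM - 1 by rewrite wtU /ind_wt eqxx subrr.
  rewrite hpartXM /hpart big1_seq ?mulr0 // => m.
  by rewrite wt_ind => /andP[/eqP/(congr1 (fun x : int => 0 <= x))]; rewrite ler0n oppr_ge0.
have [q hq] := mpoly_divX i h.
move/eqP: E0; rewrite mulf_eq0 (negPf P0) /= => /eqP h0.
move: hq; rewrite h0 add0r => hq.
have X0 : 'X_i != 0 :> {mpoly K[n]} by rewrite -msupp_eq0 msuppX.
have [|h' hh'] := IH c q; last by exists h'; rewrite hq hh' mulrA.
by apply: (mulfI X0); rewrite E hq; ring.
Qed.

End Weights.

(** * Laurent polynomials in a family of elements of a field *)

Section Laurent.
Variables (K L : fieldType) (iota : {rmorphism K -> L}) (n : nat).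
Implicit Types (z : 'I_n -> L) (l v u : 'I_n -> int) (m : 'X_{1..n}).
Implicit Types (p q : {mpoly K[n]}) (f g h : L).

Local Notation ev z p := (mmap iota z p).

Definition indep z : Prop := forall p, ev z p = 0 -> p = 0.

Lemma indep_inj z p q : indep z -> ev z p = ev z q -> p = q.
Proof. by move=> iz E; apply/eqP; rewrite -subr_eq0 (iz (p - q)) // rmorphB /= E subrr. Qed.

Lemma evX z m : ev z 'X_[m] = \prod_j z j ^+ m j.
Proof. by rewrite mmapX. Qed.

Lemma evXU z j : ev z 'X_j = z j.
Proof. by rewrite mmapX mmap1U. Qed.

Lemma mpolyX_neq0 m : 'X_[m] != 0 :> {mpoly K[n]}.
Proof. by rewrite -msupp_eq0 msuppX. Qed.

Lemma indep_neq0 z : indep z -> forall j, z j != 0.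
Proof.
move=> iz j; apply: contra_neq (mpolyX_neq0 U_(j)) => zj.
by apply: iz; rewrite evXU.
Qed.

Lemma evX_neq0 z m : (forall j, z j != 0) -> ev z 'X_[m] != 0.
Proof. by move=> nz; rewrite evX; apply/prodf_neq0 => j _; rewrite expf_neq0. Qed.

Definition laurent z f : Prop := exists m p, ev z 'X_[m] * f = ev z p.

(** The filtration by degree for the grading in which [z j] has weight [l j];
    negative weights are what separates the exchange binomials below. *)
Definition laurent_below z l (d : int) f : Prop :=
  exists m p, ev z 'X_[m] * f = ev z p /\ wt_below l (d + wt l m) p.

Lemma laurent_belowE z f : laurent z f <-> laurent_below z (fun=> 0) 0 f.
Proof.
split=> [[m [p E]]|[m [p [E _]]]]; exists m, p => //; split=> // u _.
by rewrite /wt !big1 // => j _; rewrite mul0rn.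
Qed.

Lemma laurent_belowF z l d f : laurent_below z l d f -> laurent z f.
Proof. by case=> m [p [E _]]; exists m, p. Qed.

Lemma laurent_belowW z l d d' f :
  d <= d' -> laurent_below z l d f -> laurent_below z l d' f.
Proof.
move=> dd [m [p [E lp]]]; exists m, p; split=> //.
by apply: wt_belowW lp; rewrite lerD2r.
Qed.

Lemma laurent_belowD z l d f g :
  laurent_below z l d f -> laurent_below z l d g -> laurent_below z l d (f + g).
Proof.
move=> [a [p [Ep lp]]] [b [q [Eq lq]]].
exists (a + b)%MM, ('X_[b] * p + 'X_[a] * q); split.
  by rewrite mpolyXD !(rmorphM, rmorphD) /= -Ep -Eq; ring.
rewrite wtD; apply: wt_belowD.
  by rewrite addrA addrC; apply: wt_belowM => //; apply: wt_belowX.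
by rewrite addrCA; apply: wt_belowM => //; apply: wt_belowX.
Qed.

Lemma laurent_belowM z l d e f g :
  laurent_below z l d f -> laurent_below z l e g ->
  laurent_below z l (d + e) (f * g).
Proof.
move=> [a [p [Ep lp]]] [b [q [Eq lq]]]; exists (a + b)%MM, (p * q); split.
  by rewrite mpolyXD !rmorphM /= -Ep -Eq; ring.
by rewrite wtD addrACA; apply: wt_belowM.
Qed.

Lemma laurent_belowC z l c : laurent_below z l 0 (iota c).
Proof.
exists 0%MM, c%:MP; rewrite mpolyX0 rmorph1 mul1r mmapC wt0 addr0; split=> //.
exact: wt_belowC.
Qed.

Lemma laurent_below1 z l : laurent_below z l 0 1.
Proof. by rewrite -(rmorph1 iota); apply: laurent_belowC. Qed.

Lemma laurent_belowX z l d f k :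
  laurent_below z l d f -> laurent_below z l (d *+ k) (f ^+ k).
Proof.
move=> lf; elim: k => [|k IH]; first by rewrite expr0; apply: laurent_below1.
by rewrite exprS mulrS; apply: laurent_belowM.
Qed.

Lemma laurent_below_var z l j : laurent_below z l (l j) (z j).
Proof.
exists 0%MM, 'X_j; rewrite mpolyX0 rmorph1 mul1r evXU wt0 addr0 -{1}[l j](wtU l).
by split=> //; apply: wt_belowX.
Qed.

Lemma laurent_below_inv z l j : z j != 0 -> laurent_below z l (- l j) (z j)^-1.
Proof.
move=> nz; exists U_(j)%MM, 1; rewrite evXU mulfV // rmorph1 wtU addNr.
by split=> //; rewrite -mpolyC1; apply: wt_belowC.
Qed.

Definition zmon z v : L := \prod_j z j ^ v j.

Lemma zmonD z u v : (forall j, z j != 0) ->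
  zmon z (fun j => u j + v j) = zmon z u * zmon z v.
Proof. by move=> nz; rewrite -big_split; apply: eq_bigr => j _; rewrite expfzDr. Qed.

Lemma zmon_neq0 z v : (forall j, z j != 0) -> zmon z v != 0.
Proof. by move=> nz; apply/prodf_neq0 => j _; rewrite expfz_neq0. Qed.

Lemma eq_zmon z u v : u =1 v -> zmon z u = zmon z v.
Proof. by move=> uv; apply: eq_bigr => j _; rewrite uv. Qed.

Lemma laurent_below_zmon z l v : (forall j, z j != 0) ->
  laurent_below z l (\sum_j l j * v j) (zmon z v).
Proof.
move=> nz; rewrite /zmon.
apply: (big_rec2 (laurent_below z l)) => [|j d f _ lf].
  exact: laurent_below1.
apply: laurent_belowM lf; case: (v j) => k.
  by rewrite -mulrzz -pmulrn; apply/laurent_belowX/laurent_below_var.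
rewrite NegzE mulrN -mulrzz -pmulrn -exprnN -exprVn -mulNrn.
exact/laurent_belowX/laurent_below_inv.
Qed.

Lemma laurentD z f g : laurent z f -> laurent z g -> laurent z (f + g).
Proof. by rewrite !laurent_belowE; apply: laurent_belowD. Qed.

Lemma laurentM z f g : laurent z f -> laurent z g -> laurent z (f * g).
Proof. by rewrite !laurent_belowE -[0 in X in _ -> X](addr0 0); apply: laurent_belowM. Qed.

Lemma laurentC z c : laurent z (iota c).
Proof. by rewrite laurent_belowE; apply: laurent_belowC. Qed.

Lemma laurent1 z : laurent z 1.
Proof. by rewrite -(rmorph1 iota); apply: laurentC. Qed.

Lemma laurentX z f k : laurent z f -> laurent z (f ^+ k).
Proof. by rewrite !laurent_belowE => /(laurent_belowX k); rewrite mul0rn. Qed.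

Lemma laurent_prod z (I : finType) (F : I -> L) :
  (forall i, laurent z (F i)) -> laurent z (\prod_i F i).
Proof.
move=> lF; apply: (big_ind (laurent z)) => //; first exact: laurent1.
exact: laurentM.
Qed.

Lemma laurent_var z j : laurent z (z j).
Proof. exact: laurent_belowF (laurent_below_var z (fun=> 0) j). Qed.

Lemma laurent_zmon z v : (forall j, z j != 0) -> laurent z (zmon z v).
Proof. by move=> nz; apply: laurent_belowF (laurent_below_zmon (fun=> 0) v nz). Qed.

Lemma laurent_mmap z (y : 'I_n -> L) p :
  (forall j, laurent z (y j)) -> laurent z (ev y p).
Proof.
move=> ly; rewrite /mmap.
apply: (big_ind (laurent z)) => [||m _]; first by rewrite -(rmorph0 iota); apply: laurentC.
  exact: laurentD.
by apply: laurentM (laurentC _ _) _; apply: laurent_prod => j; apply: laurentX.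
Qed.

(** ** Exchange binomials *)

Definition mpos v : 'X_{1..n} := [multinom `|Num.max (v j) 0|%N | j < n].
Definition mneg v : 'X_{1..n} := [multinom `|Num.min (v j) 0|%N | j < n].

(** The exchange polynomial for the row [v] of an exchange matrix; [binom z v] is
    its value, written with the integer exponents used for seeds. *)
Definition bpoly v : {mpoly K[n]} := 'X_[mpos v] + 'X_[mneg v].

Definition binom z v : L :=
  zmon z (fun k => Num.max (v k) 0) + zmon z (fun k => - Num.min (v k) 0).

Lemma ev_mpos z v : ev z 'X_[mpos v] = zmon z (fun k => Num.max (v k) 0).
Proof.
rewrite evX; apply: eq_bigr => j _; rewrite mnmE.
rewrite -[in RHS](gez0_abs (_ : 0 <= Num.max (v j) 0)) //.
by rewrite le_max lexx orbT.
Qed.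

Lemma ev_mneg z v : ev z 'X_[mneg v] = zmon z (fun k => - Num.min (v k) 0).
Proof.
rewrite evX; apply: eq_bigr => j _; rewrite mnmE.
by rewrite -[in RHS](lez0_abs (_ : Num.min (v j) 0 <= 0)) // ge_min lexx orbT.
Qed.

Lemma ev_bpoly z v : ev z (bpoly v) = binom z v.
Proof. by rewrite rmorphD /= ev_mpos ev_mneg. Qed.

Lemma binomE z v : (forall j, z j != 0) ->
  binom z v = ev z 'X_[mneg v] * (1 + zmon z v).
Proof.
move=> nz; rewrite mulrDr mulr1 ev_mneg -zmonD // /binom addrC; congr (_ + _).
by apply: eq_zmon => k; case: (lerP (v k) 0); rewrite ?subr0 ?oppr0 ?add0r ?addNr.
Qed.

Lemma bpoly_neq0 v : 2%:R != 0 :> K -> bpoly v != 0.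
Proof.
move=> nz2; apply/eqP => /mpolyP/(_ (mpos v)); rewrite mcoeffD !mcoeffX eqxx mcoeff0.
by case: eqP => _ /eqP; rewrite ?addr0 ?oner_eq0 -?(natrD _ 1 1) ?(negPf nz2).
Qed.

Lemma msupp_bpoly v m : m \in msupp (bpoly v) -> m = mpos v \/ m = mneg v.
Proof.
by move/msuppD_le; rewrite mem_cat !msuppX !inE => /orP[] /eqP; [left|right].
Qed.

Lemma wt_mpos l v : \sum_j l j * v j = 0 -> wt l (mpos v) = wt l (mneg v).
Proof.
move=> lv; apply/eqP; rewrite -subr_eq0 -sumrB; apply/eqP; rewrite -[RHS]lv.
apply: eq_bigr => j _; rewrite !mnmE !pmulrn !mulrzz -mulrBr; congr (_ * _).
by case: (lerP (v j) 0) => vj; lia.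
Qed.

Hypothesis nz2 : 2%:R != 0 :> K.

Lemma binom_neq0 z v : indep z -> binom z v != 0.
Proof.
move=> iz; rewrite -ev_bpoly; apply: contra_neq (bpoly_neq0 v nz2).
exact: iz.
Qed.

Lemma one_zmon_neq0 z v : indep z -> 1 + zmon z v != 0.
Proof.
move=> iz; have := binom_neq0 v iz; rewrite binomE; last exact: indep_neq0.
by rewrite mulf_eq0 negb_or => /andP[].
Qed.

(** After denominators are cleared, [1 + zmon z v] becomes homogeneous because
    [zmon z v] has weight zero, and [1 + w] acquires a monomial as top component. *)
Lemma laurent_coprime z l v w g h :
    indep z -> \sum_j l j * v j = 0 -> laurent_below z l (- 1) w ->
    laurent z g -> laurent z h -> (1 + w) * g = (1 + zmon z v) * h ->
  exists2 h', laurent z h' & g = (1 + zmon z v) * h'.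
Proof.
move=> iz lv [m [W [EW lW]]] [a [G EG]] [b [H EH]] E.
have nz := indep_neq0 iz.
pose c := mneg v.
have EP : ev z (bpoly v) = ev z 'X_[c] * (1 + zmon z v) by rewrite ev_bpoly binomE.
have [|||u [H' E']] := @homog_coprime K n l (wt l c) m (bpoly v) W
  ('X_[c + b] * G) ('X_[m + a] * H).
- by move=> k /msupp_bpoly[]-> //; apply: wt_mpos.
- by rewrite addrC.
- apply: (indep_inj iz); rewrite [RHS]rmorphM /= EP.
  rewrite !mpolyXD !(rmorphM, rmorphD) /= -EG -EH -EW.
  transitivity (ev z 'X_[m] * ev z 'X_[c] * ev z 'X_[b] * ev z 'X_[a] * ((1 + w) * g)).
    by ring.
  by rewrite E; ring.
have nu := evX_neq0 (u + (c + b) + a)%MM nz.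
exists (ev z H' * ev z 'X_[c] / ev z 'X_[u + (c + b) + a]).
  by exists (u + (c + b) + a)%MM, (H' * 'X_[c]); rewrite mulrC divfK // rmorphM.
apply: (mulfI nu); rewrite [RHS]mulrCA [X in _ = _ * X]mulrC divfK //.
move/(congr1 (mmap iota z)): E'; rewrite [RHS]rmorphM /= EP !mpolyXD !rmorphM /= -EG => E'.
transitivity (ev z 'X_[u] * (ev z 'X_[c] * ev z 'X_[b] * (ev z 'X_[a] * g))).
  by ring.
by rewrite E'; ring.
Qed.

(** The two hypotheses on [f] bound its denominator by a power of
    [1 + zmon z v] and by [1 + w], which are coprime. *)
Lemma laurent_cancel z l v w f N :
    indep z -> \sum_j l j * v j = 0 -> laurent_below z l (- 1) w ->
    laurent z ((1 + zmon z v) ^+ N * f) -> laurent z ((1 + w) * f) ->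
  laurent z f.
Proof.
move=> iz lv lw; have nz := indep_neq0 iz.
elim: N => [|N IH]; first by rewrite mul1r.
move=> lf lwf; apply: IH => //.
have lP : laurent z (1 + zmon z v).
  by apply: laurentD; [apply: laurent1 | apply: laurent_zmon].
have [||h' lh E] := laurent_coprime (h := (1 + zmon z v) ^+ N * ((1 + w) * f)) iz lv lw lf.
- by apply: laurentM => //; apply: laurentX.
- by rewrite exprS; ring.
by move: E; rewrite exprS -mulrA => /(mulfI (one_zmon_neq0 v iz)) ->.
Qed.

Lemma laurent_cancelX z l v w f N k :
    indep z -> \sum_j l j * v j = 0 -> laurent_below z l (- 1) w ->
    laurent z ((1 + zmon z v) ^+ N * f) -> laurent z ((1 + w) ^+ k * f) ->
  laurent z f.
Proof.
move=> iz lv lw lf; elim: k => [|k IH]; first by rewrite mul1r.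
rewrite exprS -mulrA => lwf; apply: IH; apply: (laurent_cancel (N := N) iz lv lw _ lwf).
rewrite mulrCA; apply: laurentM => //; apply: laurentX.
by apply: laurentD; [apply: laurent1 | apply: laurent_belowF lw].
Qed.

End Laurent.

(** * Exchange relations and Laurent rings *)

Section Exchange.
Variables (K L : fieldType) (iota : {rmorphism K -> L}) (n : nat).
Implicit Types (z y : 'I_n -> L) (l v u : 'I_n -> int) (m : 'X_{1..n}).
Implicit Types (p q : {mpoly K[n]}) (f g h : L).

Local Notation ev z p := (mmap iota z p).
Local Notation laurent := (laurent iota).
Local Notation laurent_below := (laurent_below iota).

(** Mutation acts on a cluster through a single row of the exchange matrix, so the
    effect on clusters is studied for an arbitrary row. *)
Definition mutc z k v : 'I_n -> L :=
  fun i => if i == k then (z k)^-1 * binom z v else z i.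

Lemma mutc_at z k v : mutc z k v k = (z k)^-1 * binom z v.
Proof. by rewrite /mutc eqxx. Qed.

Lemma mutc_off z k v j : j != k -> mutc z k v j = z j.
Proof. by rewrite /mutc => /negPf ->. Qed.

Lemma zmon_agree z y v : (forall j, v j != 0 -> z j = y j) -> zmon z v = zmon y v.
Proof.
move=> zy; apply: eq_bigr => j _.
by have [->|/zy ->//] := eqVneq (v j) 0; rewrite !expr0z.
Qed.

Lemma binom_agree z y v :
  (forall j, v j != 0 -> z j = y j) -> binom z v = binom y v.
Proof.
move=> zy; congr (_ + _); apply: zmon_agree => j vj; apply: zy;
by apply: contraNneq vj => ->.
Qed.

Lemma binom_mutc z k u v : v k = 0 -> binom (mutc z k u) v = binom z v.
Proof.
by move=> vk; apply: binom_agree => j; have [->|/mutc_off->//] := eqVneq j k; rewrite vk.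
Qed.

Lemma binomN z v : binom z (fun j => - v j) = binom z v.
Proof.
rewrite /binom addrC; congr (_ + _); apply: eq_zmon => j; lia.
Qed.

Lemma mutcN z k v : mutc z k (fun j => - v j) = mutc z k v.
Proof. by apply: funext => j; rewrite /mutc binomN. Qed.

Lemma mutcK z k v : z k != 0 -> binom z v != 0 -> v k = 0 ->
  mutc (mutc z k v) k v = z.
Proof.
move=> zk bz vk; apply: funext => j; rewrite {1}/mutc binom_mutc // mutc_at.
case: eqP => [->|/eqP /mutc_off-> //].
by rewrite invfM invrK mulfVK.
Qed.

(** The numerator [q'] does not depend on the cluster [y]: this allows the identity
    to be used a second time at the mutated cluster, where mutation undoes itself,
    which is how algebraic independence is transported in [indep_mutc]. *)
Lemma mutc_subst k v q : exists N q', forall y, y k != 0 ->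
  y k ^+ N * ev (mutc y k v) q = ev y q'.
Proof.
pose good (F : ('I_n -> L) -> L) :=
  exists N q', forall y, y k != 0 -> y k ^+ N * F y = ev y q'.
have goodE F G : F =1 G -> good F -> good G.
  by move=> FG [N [a Fa]]; exists N, a => y /Fa; rewrite FG.
have goodC c : good (fun=> iota c).
  by exists 0%N, c%:MP => y _; rewrite mul1r mmapC.
have goodD F G : good F -> good G -> good (fun y => F y + G y).
  move=> [N [a Fa]] [M [b Gb]]; exists (N + M)%N, ('X_k ^+ M * a + 'X_k ^+ N * b) => y yk.
  by rewrite rmorphD !rmorphM !rmorphXn /= evXU -(Fa _ yk) -(Gb _ yk) exprD; ring.
have goodM F G : good F -> good G -> good (fun y => F y * G y).
  move=> [N [a Fa]] [M [b Gb]]; exists (N + M)%N, (a * b) => y yk.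
  by rewrite rmorphM /= -(Fa _ yk) -(Gb _ yk) exprD; ring.
have goodX F r : good F -> good (fun y => F y ^+ r).
  move=> gF; elim: r => [|r IH]; first by apply: goodE (goodC 1) => y; rewrite rmorph1.
  by apply: goodE (goodM _ _ gF IH) => y; rewrite exprS.
have goodZ j : good (fun y => mutc y k v j).
  have [->|jk] := eqVneq j k.
    exists 1%N, (bpoly K v) => y yk.
    by rewrite ev_bpoly mutc_at expr1 mulrA mulfV // mul1r.
  by exists 0%N, 'X_j => y _; rewrite mul1r mutc_off // evXU.
have goodX1 m : good (fun y => ev (mutc y k v) 'X_[m]).
  apply: (goodE (fun y => \prod_j mutc y k v j ^+ m j)) => [y|]; first by rewrite evX.
  elim: (index_enum _) => [|j s IH].
    by apply: goodE (goodC 1) => y; rewrite big_nil rmorph1.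
  by apply: goodE (goodM _ _ (goodX _ (m j) (goodZ j)) IH) => y; rewrite big_cons.
rewrite -/(good (fun y => ev (mutc y k v) q)).
elim/mpolyind: q => [|c m q _ _ IH].
  by apply: goodE (goodC 0) => y; rewrite !rmorph0.
by apply: goodE (goodD _ _ (goodM _ _ (goodC c) (goodX1 m)) IH) => y; rewrite rmorphD /= mmapZ.
Qed.

Hypothesis nz2 : 2%:R != 0 :> K.

Lemma mutc_neq0 z k v : indep iota z -> v k = 0 -> forall j, mutc z k v j != 0.
Proof.
move=> iz vk j; rewrite /mutc; case: (j =P k) => _; last exact: (indep_neq0 iz).
by rewrite mulf_neq0 ?invr_eq0 ?(indep_neq0 iz) // (binom_neq0 nz2 _ iz).
Qed.

Lemma indep_mutc z k v : indep iota z -> v k = 0 -> indep iota (mutc z k v).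
Proof.
move=> iz vk q q0.
have [N [q' Eq]] := mutc_subst k v q.
have zk := indep_neq0 iz k.
have q'0 : q' = 0 by apply: iz; rewrite -Eq // q0 mulr0.
apply: (iz); have /eqP := Eq (mutc z k v) (mutc_neq0 iz vk k).
rewrite q'0 rmorph0 mutcK ?(binom_neq0 nz2 _ iz) // mulf_eq0 expf_eq0.
by rewrite (negPf (mutc_neq0 iz vk k)) andbF => /eqP.
Qed.

(** ** Elements coprime to an exchange binomial *)

Definition lunit z U : Prop := [/\ U != 0, laurent z U & laurent z U^-1].

Lemma lunitM z U V : lunit z U -> lunit z V -> lunit z (U * V).
Proof.
move=> [U0 lU lU'] [V0 lV lV']; split; rewrite ?mulf_neq0 ?invfM //; exact: laurentM.
Qed.

Lemma lunitV z U : lunit z U -> lunit z U^-1.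
Proof. by case=> U0 lU lU'; split; rewrite ?invr_eq0 ?invrK. Qed.

Lemma lunitX z U r : lunit z U -> lunit z (U ^+ r).
Proof.
by case=> U0 lU lU'; split; rewrite ?expf_neq0 -?exprVn //; apply: laurentX.
Qed.

Lemma lunit_zmon z v : (forall j, z j != 0) -> lunit z (zmon z v).
Proof.
move=> nz; split; [exact: zmon_neq0 | exact: laurent_zmon |].
have -> : (zmon z v)^-1 = zmon z (fun j => - v j).
  apply: (mulfI (zmon_neq0 v nz)); rewrite mulfV ?zmon_neq0 // -zmonD //.
  by rewrite /zmon big1 // => j _; rewrite addrN expr0z.
exact: laurent_zmon.
Qed.

Lemma lunit_var z j : (forall j, z j != 0) -> lunit z (z j).
Proof.
move=> nz; split=> //; first exact: laurent_var.
exact: laurent_belowF (laurent_below_inv iota (fun=> 0) (nz j)).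
Qed.

(** A sufficient condition for [w] to have no common factor with [1 + zmon z v]
    among Laurent polynomials in [z]: up to units it is [1] plus terms of
    negative degree for a grading that makes [1 + zmon z v] homogeneous. *)
Definition coprime_binom z v w : Prop :=
  exists l U w', [/\ \sum_j l j * v j = 0, lunit z U,
    laurent_below z l (- 1) w' & w = U * (1 + w')].

Lemma coprime_lunit z v U : lunit z U -> coprime_binom z v U.
Proof.
move=> uU; exists (fun=> 0), U, 0; split=> //; last by rewrite addr0 mulr1.
  by rewrite big1 // => j _; rewrite mul0r.
by exists 0%MM, 0; rewrite mulr0 rmorph0; split=> //; apply: wt_below0.
Qed.

Lemma coprime_laurent z v w : coprime_binom z v w -> laurent z w.
Proof.
move=> [l [U [w' [_ [_ lU _] lw' ->]]]].
by apply: laurentM lU _; apply: laurentD (laurent1 _ _) (laurent_belowF lw').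
Qed.

Lemma coprime_cancel z v w f N r :
    indep iota z -> coprime_binom z v w ->
    laurent z ((1 + zmon z v) ^+ N * f) -> laurent z (w ^+ r * f) ->
  laurent z f.
Proof.
move=> iz [l [U [w' [lv uU lw' ->]]]] lf lwf.
apply: (laurent_cancelX nz2 iz lv lw' lf (k := r)).
have [U0 _ lU'] := lunitX r uU.
by have := laurentM lU' lwf; rewrite exprMn -mulrA mulKf.
Qed.

(** A denominator of [f] divides a power of the binomial and also a product of the
    [y j], which are coprime to it. *)
Lemma coprime_transfer z y v f N :
    indep iota z -> (forall j, coprime_binom z v (y j)) ->
    laurent z ((1 + zmon z v) ^+ N * f) -> laurent y f ->
  laurent z f.
Proof.
move=> iz cy lf [m [p E]].
have ly j := coprime_laurent (cy j).
have : laurent z (ev y 'X_[m] * f) by rewrite E; apply: laurent_mmap.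
rewrite evX; elim: (index_enum _) => [|j s IH]; first by rewrite big_nil mul1r.
rewrite big_cons -mulrA => lsf; apply: IH; apply: (coprime_cancel (N := N) iz (cy j) _ lsf).
rewrite mulrCA; apply: laurentM lf.
elim: {lsf} s => [|i s IHs]; first by rewrite big_nil; apply: laurent1.
by rewrite big_cons; apply: laurentM IHs; apply: laurentX.
Qed.

End Exchange.

Section RankTwo.
Variables (K L : fieldType) (iota : {rmorphism K -> L}) (n : nat).
Implicit Types (z y : 'I_n -> L) (l v u : 'I_n -> int).
Hypothesis nz2 : 2%:R != 0 :> K.

Local Notation laurent := (laurent iota).
Local Notation laurent_below := (laurent_below iota).

Lemma zmonX z u (r : nat) : zmon z u ^+ r = zmon z (fun j => u j * r%:Z).
Proof. by rewrite -prodrXl; apply: eq_bigr => j _; rewrite exprnP exprz_exp. Qed.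

Lemma zmon_delta z (k : 'I_n) : zmon z (fun j => (j == k)%:R) = z k.
Proof.
rewrite /zmon (bigD1 k) //= eqxx expr1z big1 ?mulr1 // => j /negPf ->.
by rewrite expr0z.
Qed.

Lemma zmon_split z y i u : (forall j, j != i -> z j = y j) ->
  zmon z u = z i ^ u i * zmon y (fun j => if j == i then 0 else u j).
Proof.
move=> zy; rewrite /zmon (bigD1 i) //= [in RHS](bigD1 i) //= eqxx expr0z mul1r.
by congr (_ * _); apply: eq_bigr => j ji; rewrite (negPf ji) zy.
Qed.

Lemma sum_ind_wt (i : 'I_n) v : \sum_j ind_wt i j * v j = v i.
Proof.
rewrite (bigD1 i) //= /ind_wt eqxx mul1r big1 ?addr0 // => j /negPf ->.
by rewrite mul0r.
Qed.

Lemma mutc_factor z i v (z1 := mutc z i v) : indep iota z -> v i = 0 ->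
  z i = zmon z1 (fun j => - Num.min (v j) 0) / z1 i * (1 + zmon z1 v).
Proof.
move=> iz vi; have nz1 := mutc_neq0 nz2 iz vi.
have -> : z1 i = (z i)^-1 * binom z v by rewrite /z1 mutc_at.
rewrite -(binom_mutc z v vi) -/z1 (binomE iota) // ev_mneg invfM invrK.
set M := zmon _ _; set P := 1 + _.
have M0 : M != 0 by apply: zmon_neq0.
have P0 : P != 0 by apply: one_zmon_neq0 nz2 _ _ (indep_mutc nz2 iz vi).
by field; rewrite M0 P0.
Qed.

(** ** Two successive exchanges

    From a cluster [z], exchange in direction [k], then in direction [i], when the
    entry [b] of the matrix at [(i, k)] is positive; [v], [u] are rows [i], [k] of
    the matrix and [v'] is row [i] of the mutated matrix. Everything is expressed
    in the cluster [z1] obtained by exchanging [i] first, graded by the exponent of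
    the new variable [z1 i], for which the old variable [z i] has weight [-1]. *)

Section TwoExchanges.
Variables (z : 'I_n -> L) (i k : 'I_n) (v u : 'I_n -> int) (b : nat).
Hypotheses (iz : indep iota z) (ik : i != k) (b_gt0 : (0 < b)%N).
Hypotheses (vi : v i = 0) (vk : v k = b%:Z).
Hypotheses (ui : u i = - b%:Z) (uk : u k = 0).

Let z1 := mutc z i v.
Let nz : forall j, z j != 0 := indep_neq0 iz.
Let nz1 : forall j, z1 j != 0 := mutc_neq0 nz2 iz vi.
Let l := ind_wt i.

Let z1_off j : j != i -> z j = z1 j.
Proof. by move=> ji; rewrite /z1 mutc_off. Qed.

Let zi_zmon : z i = zmon z1 (fun j => - Num.min (v j) 0) / z1 i * (1 + zmon z1 v).
Proof. exact: mutc_factor. Qed.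

Let below_zi : laurent_below z1 l (- 1) (z i).
Proof.
rewrite zi_zmon -[-1]addr0 -[in X in X + _](add0r (-1)).
apply: laurent_belowM; first apply: laurent_belowM.
- have := laurent_below_zmon iota l (fun j => - Num.min (v j) 0) nz1.
  by rewrite sum_ind_wt vi.
- by have := laurent_below_inv iota l (nz1 i); rewrite /l /ind_wt eqxx.
- apply: laurent_belowD; first exact: laurent_below1.
  by have := laurent_below_zmon iota l v nz1; rewrite sum_ind_wt vi.
Qed.

Let A := zmon z1 (fun j => Num.max (u j) 0).

Let binom_u : exists2 V0, laurent_below z1 l 0 V0 & binom z u = A * (1 + z i * V0).
Proof.
exists (z i ^+ b.-1 * zmon z1 (fun j => if j == i then 0 else - u j)).
  rewrite -[0]addr0; apply: laurent_belowM.
    by apply: (laurent_belowW _ (laurent_belowX b.-1 below_zi)); rewrite mulNrn oppr_le0.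
  have := laurent_below_zmon iota l (fun j => if j == i then 0 else - u j) nz1.
  by rewrite sum_ind_wt eqxx.
rewrite mulrA -exprS prednK // mulrDr mulr1 mulrCA.
rewrite /binom [X in X + _](zmon_split _ z1_off) [X in _ + X](zmon_split _ z1_off).
have -> : Num.max (u i) 0 = 0 by rewrite ui; lia.
have -> : - Num.min (u i) 0 = b by rewrite ui; lia.
rewrite expr0z mul1r /A -zmonD //.
congr (_ + _ * _); apply: eq_zmon => j; have [->|_] := eqVneq j i; rewrite ?ui //; lia.
Qed.

(** Modulo [z i], which has negative weight, only the monomial of the exchange
    binomial that does not involve [z i] remains. *)
Lemma coprime_first_exchange : coprime_binom iota z1 v ((z k)^-1 * binom z u).
Proof.
have [V0 lV0 ->] := binom_u.
exists l, ((z k)^-1 * A), (z i * V0); split.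
- by rewrite sum_ind_wt.
- apply: lunitM; last exact: lunit_zmon.
  by apply: lunitV; rewrite z1_off 1?eq_sym //; apply: lunit_var.
- by rewrite -[-1]addr0; apply: laurent_belowM.
- by rewrite mulrA.
Qed.

Variable v' : 'I_n -> int.
Hypotheses (v'i : v' i = 0) (v'k : v' k = - b%:Z).
Hypothesis v'j : forall j, j != i -> j != k -> v' j = v j + b%:Z * Num.max (u j) 0.

(** Modulo [z i], the [b]-th power of the new [k]-th variable is a monomial, and the
    matrix mutation rule is exactly what makes the exchange binomial of the second
    step proportional to that of [z] in direction [i]. The latter is [z i * z1 i], so
    after division by [z i] the last variable is a unit times [z1 i] plus terms of
    lower weight. *)
Lemma coprime_second_exchange : coprime_binom iota z1 v ((z i)^-1 * binom (mutc z k u) v').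
Proof.
have [V0 lV0 Eu] := binom_u.
have [V lV EV] : exists2 V, laurent_below z1 l 0 V & (1 + z i * V0) ^+ b = 1 + z i * V.
  elim: (b) => [|r [V lV EV]].
    by exists 0; [rewrite -(rmorph0 iota); apply: laurent_belowC | rewrite mulr0 addr0].
  exists (V0 + V + z i * (V0 * V)); last by rewrite exprS EV; ring.
  apply: laurent_belowD; first exact: laurent_belowD.
  apply: (laurent_belowW (d := -1 + (0 + 0))) => //.
  by apply: laurent_belowM => //; apply: laurent_belowM.
pose m' j := if (j == i) || (j == k) then 0 else Num.max (v' j) 0.
pose n' j := if (j == i) || (j == k) then 0 else - Num.min (v' j) 0.
pose zkA := zmon z1 (fun j => Num.max (u j) 0 - (j == k)%:R).
have zkAE : (z k)^-1 * A = zkA.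
  apply: (mulfI (nz k)); rewrite mulrA mulfV // mul1r z1_off 1?eq_sym //.
  rewrite -(zmon_delta z1 k) -zmonD //; apply: eq_zmon => j; lia.
pose E := zmon z1 n' * zkA ^+ b.
have uE : lunit iota z1 E by apply: lunitM; [|apply: lunitX]; apply: lunit_zmon.
(* The two monomials of the second binomial have the same ratio, modulo [z i], as
   those of the binomial with exponents [v]. *)
have mE : zmon z1 m' = E * zmon z1 v.
  rewrite /E /zkA zmonX -!zmonD //; apply: eq_zmon => j; rewrite /m' /n'.
  have [->|ji] := eqVneq j i; first by rewrite (negPf ik) ui vi /=; lia.
  have [->|jk] := eqVneq j k; first by rewrite uk vk /=; lia.
  by rewrite /= (v'j ji jk); nia.
have bE : binom (mutc z k u) v' = E * (1 + zmon z1 v + z i * V).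
  rewrite /binom; set z2 := mutc z k u.
  have z2_off j : j != k -> z2 j = mutc z k u j by [].
  have zs w : w i = 0 ->
      zmon z2 w = z2 k ^ w k * zmon z1 (fun j => if (j == i) || (j == k) then 0 else w j).
    move=> wi; rewrite (zmon_split (y := z2) (i := k)) //; congr (_ * _).
      transitivity (zmon z2 (fun j => if (j == i) || (j == k) then 0 else w j)).
        by apply: eq_zmon => j; have [->|] := eqVneq j i; rewrite ?wi ?if_same.
      apply: zmon_agree => j; have [->|ji] := eqVneq j i => //=.
      by have [->|jk] := eqVneq j k => //= _; rewrite /z2 mutc_off // z1_off.
  rewrite !zs ?v'i // v'k.
  have -> : Num.max (- b%:Z) 0 = 0 by lia.
  have -> : - Num.min (- b%:Z) 0 = b%:Z by lia.
  rewrite expr0z mul1r -/m' -/n' mE /z2 mutc_at Eu mulrA zkAE -exprnP exprMn EV /E.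
  by ring.
exists l, (E * z1 i / zmon z1 (fun j => - Num.min (v j) 0)),
  (V * zmon z1 (fun j => - Num.min (v j) 0) / z1 i); split.
- by rewrite sum_ind_wt.
- apply: lunitM; last exact/lunitV/lunit_zmon.
  by apply: lunitM => //; apply: lunit_var.
- rewrite -[-1]add0r; apply: laurent_belowM; first rewrite -[0]addr0.
    apply: laurent_belowM => //.
    have := laurent_below_zmon iota l (fun j => - Num.min (v j) 0) nz1.
    by rewrite sum_ind_wt vi.
  by have := laurent_below_inv iota l (nz1 i); rewrite /l /ind_wt eqxx.
rewrite bE; move: zi_zmon (nz i) (nz1 i).
have M0 : zmon z1 (fun j => - Num.min (v j) 0) != 0 by apply: zmon_neq0.
move: (zmon z1 (fun j => - Num.min (v j) 0)) M0 => M M0 zi zi0 z1i0.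
have -> : 1 + zmon z1 v = z i * z1 i / M by rewrite zi; field; rewrite M0 z1i0.
by field; rewrite M0 z1i0 zi0.
Qed.

End TwoExchanges.

End RankTwo.

(** * Exchange matrices *)

Section ExchangeMatrices.
Variable n : nat.
Implicit Types B : 'M[int]_n.


(** Invertibility over the rationals, in the form that mutation transforms
    explicitly: a linear relation between the rows is trivial. *)
Definition nondeg B : Prop := forall c : 'I_n -> rat,
  (forall j, \sum_i c i * (B i j)%:~R = 0) -> forall i, c i = 0.

Lemma skewE B : skew_symmetric B -> forall i j, B i j = - B j i.
Proof. by move=> sB i j; have /matrixP/(_ j i) := sB; rewrite !mxE. Qed.

Lemma skew_diag B : skew_symmetric B -> forall i, B i i = 0.
Proof. by move=> /skewE sB i; have := sB i i; lia. Qed.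

Lemma half_pos (a c : int) : 0 <= a -> ((`|a| * c + a * `|c|) %/ 2)%Z = a * Num.max c 0.
Proof.
move=> a0; have -> : `|a| * c + a * `|c| = (a * Num.max c 0) * 2.
  rewrite ger0_norm //; case: (lerP c 0) => c0.
    by rewrite ler0_norm //; ring.
  by rewrite gtr0_norm //; ring.
by rewrite mulzK.
Qed.

Lemma half_neg (a c : int) : a <= 0 -> ((`|a| * c + a * `|c|) %/ 2)%Z = - a * Num.min c 0.
Proof.
move=> a0; have -> : `|a| * c + a * `|c| = (- a * Num.min c 0) * 2.
  rewrite ler0_norm //; case: (lerP c 0) => c0.
    by rewrite ler0_norm //; ring.
  by rewrite gtr0_norm //; ring.
by rewrite mulzK.
Qed.

Lemma half_skew (a c : int) :
  ((`|- c| * - a + - c * `|- a|) %/ 2)%Z = - ((`|a| * c + a * `|c|) %/ 2)%Z.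
Proof.
have -> : ((`|a| * c + a * `|c|) %/ 2)%Z =
    if a <= 0 then - a * Num.min c 0 else a * Num.max c 0.
  by have [/half_neg|/ltW/half_pos] := lerP a 0; apply.
have -> : ((`|- c| * - a + - c * `|- a|) %/ 2)%Z =
    if c <= 0 then - c * Num.max (- a) 0 else c * Num.min (- a) 0.
  have [c0|c0] := lerP c 0; first by rewrite half_pos ?oppr_ge0.
  by rewrite half_neg ?oppr_le0 ?opprK // ltW.
by have [a0|a0] := lerP a 0; have [c0|c0] := lerP c 0; nia.
Qed.

Lemma half_double (a c : int) :
  ((`|a| * c + a * `|c|) %/ 2)%Z * 2 = `|a| * c + a * `|c|.
Proof.
have [a0|/ltW a0] := lerP a 0; [rewrite (half_neg c a0) | rewrite (half_pos c a0)]; nia.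
Qed.

Lemma mutate_skew B k : skew_symmetric B -> skew_symmetric (mutate_mx B k).
Proof.
move=> sB; have sE := skewE sB; apply/matrixP => i j; rewrite !mxE orbC.
case: ifP => _; first by rewrite sE.
by rewrite (sE j i) (sE j k) (sE k i) half_skew opprD.
Qed.

Lemma mutate_mxN B k : mutate_mx (- B) k = - mutate_mx B k.
Proof.
apply/matrixP => i j; rewrite !mxE; case: ifP => // _; rewrite opprD; congr (_ + _).
rewrite -half_skew !normrN; congr (_ %/ _)%Z; ring.
Qed.

(** If [c] is a linear relation between the rows of the mutated matrix, then
    changing the coefficient of row [k] gives one between the rows of [B]. *)
Lemma mutate_nondeg B k : skew_symmetric B -> nondeg B -> nondeg (mutate_mx B k).
Proof.
move=> sB ndB c Hc; have Bkk := skew_diag sB k.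
have ck : \sum_i c i * (B i k)%:~R = 0.
  rewrite -[RHS]oppr0 -[in RHS](Hc k) -sumrN; apply: eq_bigr => i _.
  by rewrite mxE eqxx orbT mulrNz mulrN opprK.
pose d := 2^-1 * \sum_i c i * `|B i k|%:~R - c k.
have cd0 : forall i, (if i == k then d else c i) = 0.
  apply: ndB => j; rewrite (bigD1 k) //= eqxx.
  have [->|jk] := eqVneq j k.
    rewrite Bkk mulr0 add0r -[RHS]ck [in RHS](bigD1 k) //= Bkk mulr0 add0r.
    by apply: eq_bigr => i /negPf ->.
  have := Hc j; rewrite (bigD1 k) //= mxE eqxx /= mulrNz mulrN => Ej.
  rewrite (eq_bigr (fun i => c i * (mutate_mx B k i j)%:~R
    - 2^-1 * (B k j)%:~R * (c i * `|B i k|%:~R)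
    - 2^-1 * `|B k j|%:~R * (c i * (B i k)%:~R))) => [|i ik]; last first.
    rewrite (negPf ik) mxE (negPf ik) (negPf jk) /=.
    set h := (_ %/ _)%Z.
    have H : h%:~R * 2 = `|B i k|%:~R * (B k j)%:~R + (B i k)%:~R * `|B k j|%:~R :> rat.
      by rewrite -!intrM -intrD -half_double intrM.
    have -> : (B i j + h)%:~R = (B i j)%:~R + h%:~R * 2 / 2 :> rat.
      by rewrite intrD; field.
    by rewrite H; field.
  rewrite !sumrB -!mulr_sumr.
  have -> : \sum_(i | i != k) c i * (B i k)%:~R = 0.
    by rewrite -[RHS]ck [in RHS](bigD1 k) //= Bkk mulr0 add0r.
  have dE : d = 2^-1 * \sum_(i | i != k) c i * `|B i k|%:~R - c k.
    by rewrite /d (bigD1 k) //= Bkk normr0 mulr0 add0r.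
  move: Ej => /eqP; rewrite addrC subr_eq0 => /eqP ->.
  by rewrite mulr0 subr0 dE; ring.
have ci i : i != k -> c i = 0 by move=> /negPf ik; have := cd0 i; rewrite ik.
move=> i; have [->|/ci//] := eqVneq i k.
have := cd0 k; rewrite eqxx /d big1 => [|x _]; last first.
  by have [->|/ci->] := eqVneq x k; rewrite ?Bkk ?normr0 ?mulr0 ?mul0r.
by rewrite mulr0 sub0r => /eqP; rewrite oppr_eq0 => /eqP.
Qed.

(** Otherwise all two-by-two minors of rows [i] and [k] vanish, and the entries of
    one column are the coefficients of a relation between these rows. *)
Lemma nondeg_rows B i k : nondeg B -> i != k ->
  exists a c, B i a * B k c != B i c * B k a.
Proof.
move=> ndB ik; apply: contrapT => H.
have H' a c : B i a * B k c = B i c * B k a.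
  by apply/eqP/negPn/negP => ac; apply: H; exists a, c.
have rowk a : B k a = 0.
  pose c j : rat := (B k a)%:~R * (j == i)%:R - (B i a)%:~R * (j == k)%:R.
  have /(_ i) : forall j, c j = 0.
    apply: ndB => j; rewrite (bigD1 i) //= (bigD1 k) 1?eq_sym //= big1 => [|x /andP[xi xk]].
      rewrite /c !eqxx (negPf ik) eq_sym (negPf ik) !mulr0 !mulr1 subr0 sub0r addr0.
      by rewrite mulNr -!intrM -intrB /= mulrC -H' mulrC subrr.
    by rewrite /c (negPf xi) (negPf xk) !mulr0 subrr mul0r.
  rewrite /c eqxx (negPf ik) mulr0 mulr1 subr0 => /eqP.
  by rewrite intr_eq0 => /eqP.
have /(_ k) : forall j, (j == k)%:R = 0 :> rat.
  apply: ndB => j; rewrite (bigD1 k) //= rowk mulr0 big1 ?addr0 // => x /negPf ->.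
  by rewrite mul0r.
by rewrite eqxx => /eqP; rewrite oner_eq0.
Qed.

End ExchangeMatrices.

Section Upper.
Variables (K L : fieldType) (iota : {rmorphism K -> L}) (n : nat).
Implicit Types (z y : 'I_n -> L) (l v u : 'I_n -> int) (B : 'M[int]_n).
Local Notation laurent := (laurent iota).
Local Notation laurent_below := (laurent_below iota).
Local Notation coprime_binom := (coprime_binom iota).

Lemma coprime_binomN z v w : coprime_binom z (fun j => - v j) w -> coprime_binom z v w.
Proof.
move=> [l [U [w' [lv uU lw Ew]]]]; exists l, U, w'; split=> //.
apply: oppr_inj; rewrite oppr0 -[RHS]lv -sumrN; apply: eq_bigr => j _.
by rewrite mulrN.
Qed.

(** The form is, up to sign, the two-by-two minor with [v] as one of its rows. *)
Lemma separating_weight v u a c : v a * u c != v c * u a ->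
  exists2 l, \sum_j l j * v j = 0 & \sum_j l j * u j <= - 1.
Proof.
pose l (e : int) j := e * (v c * ind_wt a j - v a * ind_wt c j).
have lE e x : \sum_j l e j * x j = e * (v c * x a - v a * x c).
  rewrite -(sum_ind_wt a x) -(sum_ind_wt c x) !mulr_sumr -sumrB mulr_sumr.
  by apply: eq_bigr => j _; rewrite /l; ring.
move=> ne; have [lt|lt] := lerP (v c * u a) (v a * u c).
  by exists (l 1); rewrite lE; [ring | lia].
by exists (l (-1)); rewrite lE; [ring | lia].
Qed.

Hypothesis nz2 : 2%:R != 0 :> K.

(** When the entry at [(i, k)] is zero the exponents of the two binomials do not
    involve [z i] or [z k], and not being parallel makes the binomials coprime. *)
Lemma coprime_commuting_exchange z i k v u :
    indep iota z -> i != k -> v i = 0 -> v k = 0 -> u i = 0 -> u k = 0 ->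
    (exists a c, v a * u c != v c * u a) ->
  coprime_binom (mutc z i v) v ((z k)^-1 * binom z u).
Proof.
move=> iz ik vi vk ui uk [a [c /separating_weight[l lv lu]]].
have nz1 := mutc_neq0 nz2 iz vi.
rewrite -(binom_mutc z v ui) (binomE iota) // ev_mneg mulrA.
exists l, ((z k)^-1 * zmon (mutc z i v) (fun j => - Num.min (u j) 0)),
  (zmon (mutc z i v) u); split=> //.
  apply: lunitM; last exact: lunit_zmon.
  by apply: lunitV; rewrite -(mutc_off z v (j := k) (k := i)) 1?eq_sym //; apply: lunit_var.
exact: laurent_belowW lu (laurent_below_zmon iota l u nz1).
Qed.

Lemma laurent_mutc_var z i v j : indep iota z -> v i = 0 ->
  laurent (mutc z i v) (z j).
Proof.
move=> iz vi; have nz1 := mutc_neq0 nz2 iz vi.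
have [->|ji] := eqVneq j i; last by rewrite -(mutc_off z v ji); apply: laurent_var.
rewrite (mutc_factor nz2 iz vi); apply: laurentM; first apply: laurentM.
- exact: laurent_zmon.
- by have [] := lunitV (lunit_var iota i nz1).
- by apply: laurentD (laurent1 _ _) _; apply: laurent_zmon.
Qed.

(** The variable [z i] is a unit times the exchange binomial, and the other
    variables are common to both clusters. *)
Lemma laurent_mutc z i v f : indep iota z -> v i = 0 -> laurent z f ->
  exists N, laurent (mutc z i v) ((1 + zmon (mutc z i v) v) ^+ N * f).
Proof.
move=> iz vi [m [p E]]; set z1 := mutc z i v.
have nz1 := mutc_neq0 nz2 iz vi.
pose U := zmon z1 (fun j => - Num.min (v j) 0) / z1 i.
have uU : lunit iota z1 U.
  by apply: lunitM; [exact: lunit_zmon | apply: lunitV; exact: lunit_var].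
exists (m i).
pose W := U ^+ m i * \prod_(j | j != i) z1 j ^+ m j.
have [W0 _ lW] : lunit iota z1 W.
  apply: lunitM; first exact: lunitX.
  apply: (big_ind (lunit iota z1)) => [||j _].
  - by split; rewrite ?oner_eq0 ?invr1 //; apply: laurent1.
  - exact: lunitM.
  - by apply: lunitX; apply: lunit_var.
have -> : (1 + zmon z1 v) ^+ m i * f = W^-1 * (mmap iota z p).
  apply: (mulfI W0); rewrite mulVKf // -E evX (bigD1 i) //=.
  rewrite (mutc_factor nz2 iz vi) -/z1 -/U exprMn /W.
  rewrite [in RHS](eq_bigr (fun j => z1 j ^+ m j)) => [|j ji]; last by rewrite /z1 mutc_off.
  by ring.
by apply: laurentM lW _; apply: laurent_mmap => j; apply: laurent_mutc_var.
Qed.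

Lemma coprime_exchange_ge0 z B i k (v := B i) : indep iota z ->
    skew_symmetric B -> nondeg B -> i != k -> 0 <= B i k ->
  coprime_binom (mutc z i v) v ((z k)^-1 * binom z (B k)) /\
  coprime_binom (mutc z i v) v
    ((z i)^-1 * binom (mutc z k (B k)) (mutate_mx B k i)).
Proof.
move=> iz sB ndB ik; have sE := skewE sB; have dE := skew_diag sB.
rewrite le_eqVlt => /orP[/eqP/esym B0|B_gt0].
  have Bki : B k i = 0 by rewrite sE B0.
  split; first exact: coprime_commuting_exchange (nondeg_rows ndB ik).
  have -> : mutate_mx B k i = B i :> (_ -> _).
    apply: funext => j; rewrite mxE (negPf ik) /=; case: eqP => [->|_].
      by rewrite B0.
    by rewrite B0 half_pos // mul0r addr0.
  rewrite binom_mutc // -mutc_at; apply: coprime_lunit; apply: lunit_var.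
  exact: (mutc_neq0 (v := B i) nz2 iz (dE i)).
have Bb : B i k = `|B i k|%N%:Z by rewrite gez0_abs // ltW.
have b0 : (0 < `|B i k|)%N by rewrite absz_gt0 gt_eqF.
have Bki : B k i = - `|B i k|%N%:Z by rewrite sE -Bb.
split; first by apply: (coprime_first_exchange (v := B i) (u := B k) nz2 iz ik b0); rewrite ?dE.
apply: (coprime_second_exchange (v := B i) (u := B k) nz2 iz ik b0); rewrite ?dE //.
- by rewrite mxE (negPf ik) dE /= Bki -Bb half_pos ?ltW //; lia.
- by rewrite mxE eqxx orbT -Bb.
- by move=> j ji jk; rewrite mxE (negPf ik) (negPf jk) /= half_pos ?ltW // -Bb.
Qed.

(** Changing the sign of the matrix changes neither the exchange binomials nor, up
    to sign, the mutated matrix. *)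
Lemma coprime_exchange z B i k (v := B i) : indep iota z ->
    skew_symmetric B -> nondeg B -> i != k ->
  coprime_binom (mutc z i v) v ((z k)^-1 * binom z (B k)) /\
  coprime_binom (mutc z i v) v
    ((z i)^-1 * binom (mutc z k (B k)) (mutate_mx B k i)).
Proof.
move=> iz sB ndB ik; have [B0|B0] := lerP 0 (B i k); first exact: coprime_exchange_ge0.
have NE (C : 'M[int]_n) j : (- C) j = (fun x => - C j x) :> (_ -> _).
  by apply: funext => x; rewrite mxE.
have ndNB : nondeg (- B).
  move=> c Hc; apply: ndB => j; apply: oppr_inj; rewrite oppr0 -[RHS](Hc j) -sumrN.
  by apply: eq_bigr => x _; rewrite mxE mulrNz mulrN.
have [||] := coprime_exchange_ge0 iz _ ndNB ik.
- by rewrite /skew_symmetric linearN /= sB.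
- by rewrite mxE oppr_ge0 ltW.
rewrite mutate_mxN !NE !mutcN !binomN.
by split; apply: coprime_binomN.
Qed.

(** In geometric terms: the tori of the clusters [z] and
    [mutc (mutc z k _) i _] together cover the torus of [mutc z i _] up to
    codimension two, since on the divisor where [z i] vanishes the two new
    variables of the second cluster are generically invertible. *)
Lemma laurent_exchange z B i k f : indep iota z ->
    skew_symmetric B -> nondeg B -> i != k ->
    laurent z f -> laurent (mutc (mutc z k (B k)) i (mutate_mx B k i)) f ->
  laurent (mutc z i (B i)) f.
Proof.
move=> iz sB ndB ik lf lf3; have dE := skew_diag sB.
have [N lN] := laurent_mutc (v := B i) iz (dE i) lf.
have [c1 c2] := coprime_exchange iz sB ndB ik.
apply: (coprime_transfer nz2 (indep_mutc (v := B i) nz2 iz (dE i)) _ lN lf3) => j.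
have [->|ji] := eqVneq j i; first by rewrite mutc_at mutc_off.
rewrite mutc_off //; have [->|jk] := eqVneq j k; first by rewrite mutc_at.
rewrite mutc_off // -(mutc_off z (B i) ji); apply: coprime_lunit.
by apply: lunit_var; apply: (mutc_neq0 (v := B i) nz2 iz (dE i)).
Qed.

End Upper.

(** * The Laurent phenomenon *)

Section LaurentPhenomenon.
Variables (K : fieldType) (n : nat).
Hypothesis nz2 : 2%:R != 0 :> K.
Implicit Types (s : seed K n) (f : ratfun K n) (B : 'M[int]_n).

Definition cst : {rmorphism K -> ratfun K n} := in_alg (ratfun K n).

Definition good_seed s : Prop :=
  [/\ indep cst (cluster s), skew_symmetric (exchange s) & nondeg (exchange s)].

Lemma cluster_mutate s k :
  cluster (mutate s k) = mutc (cluster s) k (exchange s k).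
Proof. by []. Qed.

Lemma good_mutate s k : good_seed s -> good_seed (mutate s k).
Proof.
case=> iz sB ndB; split; [|exact: (mutate_skew k sB)|exact: (mutate_nondeg (k := k) sB ndB)].
by rewrite cluster_mutate; apply: (indep_mutc nz2 iz); apply: skew_diag.
Qed.

(** The upper bound algebra of Berenstein, Fomin and Zelevinsky. *)
Definition upper_bound s f : Prop :=
  laurent cst (cluster s) f /\ forall i, laurent cst (cluster (mutate s i)) f.

Lemma upper_bound_cluster s j : good_seed s -> upper_bound s (cluster s j).
Proof.
case=> iz sB _; split=> [|i]; first exact: laurent_var.
by rewrite cluster_mutate; apply: (laurent_mutc_var nz2 _ iz); apply: skew_diag.
Qed.

(** Mutating twice in direction [k] gives back the cluster, and the clusters adjacent
    in the other directions are handled by [laurent_exchange]. *)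
Lemma upper_bound_mutate s k f :
  good_seed s -> upper_bound (mutate s k) f -> upper_bound s f.
Proof.
move=> [iz sB ndB] [l1 l2]; have dE := skew_diag sB.
have lz : laurent cst (cluster s) f.
  have := l2 k; rewrite !cluster_mutate /=.
  have -> : mutate_mx (exchange s) k k = (fun j => - exchange s k j) :> (_ -> _).
    by apply: funext => j; rewrite mxE eqxx.
  by rewrite mutcN mutcK ?(binom_neq0 nz2 _ iz) ?(indep_neq0 iz).
split=> // i; have [->//|ik] := eqVneq i k.
by apply: (laurent_exchange nz2 iz sB ndB ik lz (l2 i)).
Qed.

Lemma upper_bound_reached s w j :
  good_seed s -> upper_bound s (cluster (foldl (@mutate K n) s w) j).
Proof.
elim: w s => [|k w IH] s gs /=; first exact: upper_bound_cluster.
by apply: (upper_bound_mutate (k := k)) => //; apply: IH; apply: good_mutate.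
Qed.

Lemma indep_var : indep cst (@ratfun_var K n).
Proof.
have E p : mmap cst (@ratfun_var K n) p = tofrac p.
  elim/mpolyind: p => [|c m p _ _ IH]; first by rewrite !rmorph0.
  rewrite !rmorphD /= IH mmapZ -mul_mpolyC rmorphM /= evX; congr (_ * _ + _).
    exact: mulr1.
  by rewrite mpolyXE_id rmorph_prod; apply: eq_bigr => i _; rewrite rmorphXn.
by move=> p; rewrite E => /eqP; rewrite tofrac_eq0 => /eqP.
Qed.

Lemma good_initial B : skew_symmetric B -> nondeg B -> good_seed (initial_seed K B).
Proof. by move=> sB ndB; split=> //; apply: indep_var. Qed.

Lemma laurentZ (z : 'I_n -> ratfun K n) c f :
  laurent cst z f -> laurent cst z (c *: f).
Proof. by move=> lf; rewrite -mulr_algl; apply: laurentM lf; apply: laurentC. Qed.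

Lemma upper_bound_closed s :
  GRing.subalg_closed (fun f => `[< upper_bound s f >] : bool).
Proof.
split=> [|c f g /asboolP[f1 f2] /asboolP[g1 g2]|f g /asboolP[f1 f2] /asboolP[g1 g2]];
  apply/asboolP; split=> [|i].
- exact: laurent1.
- exact: laurent1.
- by apply: laurentD => //; apply: laurentZ.
- by apply: laurentD => //; apply: laurentZ.
- exact: laurentM.
- exact: laurentM.
Qed.

Lemma cluster_algebra_upper_bound B (a : cluster_algebra K B) :
  skew_symmetric B -> nondeg B -> upper_bound (initial_seed K B) (val a).
Proof.
move=> sB ndB; have gs := good_initial sB ndB.
have /asboolP/(_ _ (upper_bound_closed (initial_seed K B))) := valP a.
move=> H; apply/asboolP; apply: H => g [w [j ->]].
by apply/asboolP; apply: upper_bound_reached.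
Qed.

End LaurentPhenomenon.

(** * Functions regular on two adjacent tori *)

Section TwoTori.
Variables (K L : fieldType) (iota : {rmorphism K -> L}) (n : nat).
Hypothesis nz2 : 2%:R != 0 :> K.
Implicit Types (z : 'I_n -> L) (v : 'I_n -> int) (m : 'X_{1..n}) (i : 'I_n).
Implicit Types (p q : {mpoly K[n]}).

Local Notation ev z p := (mmap iota z p).
Local Notation laurent := (laurent iota).

Definition mnm_off i m : 'X_{1..n} := [multinom if j == i then 0%N else m j | j < n].

Lemma mnm_offE i m : mnm_off i m i = 0%N.
Proof. by rewrite mnmE eqxx. Qed.

Lemma mnm_offD i m : m = (mnm_off i m + U_(i) *+ m i)%MM.
Proof.
apply/mnmP => j; rewrite mnmDE mnmE mulmnE mnm1E eq_sym.
by case: eqP => [->|]; rewrite ?mul1n ?mul0n ?addn0.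
Qed.

Lemma mpolyX_off i m : 'X_[m] = 'X_[mnm_off i m] * 'X_i ^+ m i :> {mpoly K[n]}.
Proof. by rewrite {1}(mnm_offD i m) mpolyXD mpolyXn. Qed.

Lemma evX_off z i m : ev z 'X_[m] = ev z 'X_[mnm_off i m] * z i ^+ m i.
Proof. by rewrite (mpolyX_off i) rmorphM rmorphXn /= evXU. Qed.

Lemma evX_mutc z i v m : m i = 0%N -> ev (mutc z i v) 'X_[m] = ev z 'X_[m].
Proof.
move=> mi; rewrite !evX; apply: eq_bigr => j _.
by have [->|ji] := eqVneq j i; [rewrite mi | rewrite mutc_off].
Qed.

Lemma msupp_bpolyX i v N m : v i = 0 -> m \in msupp (bpoly K v ^+ N) -> m i = 0%N.
Proof.
move=> vi; elim: N m => [|N IH] m; first by rewrite msupp1 inE => /eqP ->; rewrite mnm0E.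
rewrite exprS => /msuppM_le/allpairsP[[a b] /= [/msupp_bpoly ha /IH hb ->]].
rewrite mnmDE hb addn0.
by case: ha => ->; rewrite mnmE vi.
Qed.

(** Because [(z i)^-1] is the new variable divided by the exchange binomial, the
    negative powers of [z i] in a Laurent polynomial become polynomial in the new
    variable at the cost of a power of the binomial. *)
Lemma polar_part z i v N p : z i != 0 -> v i = 0 ->
  exists d c, binom z v ^+ N * (ev z p - z i ^+ N * ev z d)
              = z i ^+ N * ev (mutc z i v) c.
Proof.
move=> zi vi; elim/mpolyind: p => [|a m p _ _ [d [c E]]].
  by exists 0, 0; rewrite !rmorph0 !mulr0 subrr mulr0.
have [Nm|mN] := leqP N (m i).
  exists (d + a *: 'X_[m - U_(i) *+ N]), c.
  rewrite -E; congr (_ * _); rewrite !rmorphD /= !mmapZ.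
  have -> : ev z 'X_[m] = z i ^+ N * ev z 'X_[m - U_(i) *+ N].
    rewrite -{1}(submK (m := U_(i) *+ N) (m' := m)) ?mpolyXD ?rmorphM /=.
      by rewrite -mpolyXn rmorphXn /= evXU mulrC.
    apply/mnm_lepP => j; rewrite mulmnE mnm1E; case: eqP => [<-|_]; last by rewrite mul0n.
    by rewrite mul1n.
  by ring.
exists d, (c + a *: ('X_[mnm_off i m] * bpoly K v ^+ m i * 'X_i ^+ (N - m i))).
have -> : z i ^+ N * ev (mutc z i v)
    (c + a *: ('X_[mnm_off i m] * bpoly K v ^+ m i * 'X_i ^+ (N - m i))) =
  binom z v ^+ N * (ev z p - z i ^+ N * ev z d) + binom z v ^+ N * (iota a * ev z 'X_[m]).
  rewrite rmorphD mulrDr /= -E mmapZ !rmorphM !rmorphXn /= ev_bpoly binom_mutc // evXU.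
  rewrite evX_mutc ?mnm_offE // (evX_off z i m) mutc_at.
  congr (_ + _); rewrite exprMn exprVn -[in LHS](subnK (ltnW mN)).
  rewrite -[in RHS](subnK (ltnW mN)) !exprD addnK.
  have := expf_neq0 (N - m i) zi; move: (z i ^+ (N - m i)) => y y0.
  by field.
by rewrite rmorphD /= mmapZ; ring.
Qed.

(** Remove from [f] its part that is polynomial in [z i]. The rest has a power of
    the exchange binomial as denominator by [polar_part], and a power of the new
    variable since [f] is a Laurent polynomial in the mutated cluster; these are
    coprime. The monomial [m] only clears the variables common to both clusters. *)
Lemma two_tori z i v f : indep iota z -> v i = 0 ->
    laurent z f -> laurent (mutc z i v) f ->
  exists m d c, m i = 0%N /\ ev z 'X_[m] * f = ev z d + ev (mutc z i v) c.
Proof.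
move=> iz vi [a [g Eg]] lf; set z1 := mutc z i v.
have nz := indep_neq0 iz; have iz1 : indep iota z1 := indep_mutc nz2 iz vi.
have nz1 := indep_neq0 iz1.
have [d [c0 E]] := polar_part (a i) g (nz i) vi.
pose f1 := ev z 'X_[mnm_off i a] * f - ev z d.
have Pf1 : binom z v ^+ a i * f1 = ev z1 c0.
  apply: (mulfI (expf_neq0 (a i) (nz i))); rewrite -E -Eg (evX_off z i a) /f1.
  by ring.
have [b [c1 E1]] : laurent z1 f1.
  have lz p : laurent z1 (ev z p).
    by apply: laurent_mmap => j; apply: laurent_mutc_var.
  by apply: laurentD; [apply: laurentM | rewrite -rmorphN; apply: lz].
have E2 : 'X_i ^+ b i * ('X_[mnm_off i b] * c0) = bpoly K v ^+ a i * c1.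
  apply: (indep_inj iz1); rewrite !(rmorphM, rmorphXn) /= ev_bpoly -E1.
  by rewrite (evX_off z1 i b) binom_mutc // -Pf1 evXU; ring.
have [||c2 Ec1] := mpolyX_coprime _ _ E2.
- by rewrite expf_neq0 ?bpoly_neq0.
- by move=> m; apply: msupp_bpolyX.
exists (mnm_off i a + mnm_off i b)%MM, ('X_[mnm_off i b] * d), c2.
split; first by rewrite mnmDE !mnm_offE.
have E3 : ev z1 'X_[mnm_off i b] * f1 = ev z1 c2.
  apply: (mulfI (expf_neq0 (b i) (nz1 i))).
  by rewrite mulrA [_ * ev z1 _]mulrC -evX_off E1 Ec1 rmorphM rmorphXn /= evXU.
rewrite -E3 evX_mutc ?mnm_offE // mpolyXD !rmorphM /= /f1.
by ring.
Qed.

End TwoTori.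

(** * Cotangent spaces *)

Section Cotangent.
Variables (K : fieldType) (A : comAlgType K) (p : point A).
Implicit Types (a b r s : A).

Local Notation sq := (in_max_ideal_sq p).

Lemma point_alg (c : K) : p c%:A = c.
Proof. by rewrite linearZ rmorph1 /= mulr1. Qed.

Lemma sq0 : sq 0.
Proof. by exists 0%N, (fun=> 0), (fun=> 0); split=> [[]|[]|] //; rewrite big_ord0. Qed.

Lemma sqD a b : sq a -> sq b -> sq (a + b).
Proof.
move=> [m1 [u1 [v1 [hu1 hv1 ->]]]] [m2 [u2 [v2 [hu2 hv2 ->]]]].
pose glue (f : 'I_m1 -> A) (g : 'I_m2 -> A) i :=
  match split i with inl j => f j | inr j => g j end.
have hg f g : (forall i, in_max_ideal p (f i)) -> (forall i, in_max_ideal p (g i)) ->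
    forall i, in_max_ideal p (glue f g i).
  by move=> hf hg i; rewrite /glue; case: (split i).
exists (m1 + m2)%N, (glue u1 u2), (glue v1 v2); split; [exact: hg | exact: hg |].
rewrite big_split_ord /=; congr (_ + _); apply: eq_bigr => i _; rewrite /glue.
  by rewrite (unsplitK (inl i)).
by rewrite (unsplitK (inr i)).
Qed.

Lemma sqM a b : sq b -> sq (a * b).
Proof.
move=> [m [u [v [hu hv ->]]]]; exists m, (fun i => a * u i), v; split=> // [i|].
  by rewrite /in_max_ideal rmorphM /= hu mulr0.
by rewrite mulr_sumr; apply: eq_bigr => i _; rewrite mulrA.
Qed.

Lemma sqN a : sq a -> sq (- a).
Proof. by rewrite -mulN1r; apply: sqM. Qed.

Lemma sq_mul a b : p a = 0 -> p b = 0 -> sq (a * b).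
Proof.
by move=> ha hb; exists 1%N, (fun=> a), (fun=> b); split=> //; rewrite big_ord1.
Qed.

Lemma sq_shift a b : sq ((a - (p a)%:A) * (b - (p b)%:A)).
Proof. by apply: sq_mul; rewrite rmorphB /= point_alg subrr. Qed.

Section Span.
Variables (d : nat) (e : 'I_d -> A).

(** The elements whose differential at [p] is a combination of the classes of
    the [e i]. *)
Definition cot_span a : Prop :=
  exists c : 'I_d -> K, sq (a - (p a)%:A - \sum_i (c i)%:A * e i).

Let lin (c : 'I_d -> K) : A := \sum_i (c i)%:A * e i.

Let linD c c' : lin (fun i => c i + c' i) = lin c + lin c'.
Proof. by rewrite -big_split /=; apply: eq_bigr => i _; rewrite scalerDl mulrDl. Qed.

Let linZ k c : lin (fun i => k * c i) = k%:A * lin c.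
Proof.
by rewrite mulr_sumr; apply: eq_bigr => i _; rewrite -scalerA -mulr_algl mulrA.
Qed.

Lemma cot_spanC c : cot_span c%:A.
Proof.
exists (fun=> 0); rewrite point_alg subrr sub0r big1 ?oppr0 => [|i _]; first exact: sq0.
by rewrite scale0r mul0r.
Qed.

Lemma cot_span_gen j a : e j = a - (p a)%:A -> cot_span a.
Proof.
move=> ej; exists (fun i => (i == j)%:R); rewrite (bigD1 j) //= eqxx scale1r mul1r.
rewrite -ej big1 ?addr0 ?subrr => [|i /negPf ->]; first exact: sq0.
by rewrite scale0r mul0r.
Qed.

Lemma cot_spanD a b : cot_span a -> cot_span b -> cot_span (a + b).
Proof.
move=> [c hc] [c' hc']; exists (fun i => c i + c' i).
rewrite -/(lin _) linD rmorphD scalerDl.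
have -> : a + b - ((p a)%:A + (p b)%:A) - (lin c + lin c') =
  (a - (p a)%:A - lin c) + (b - (p b)%:A - lin c') by ring.
exact: sqD.
Qed.

Lemma cot_spanM a b : cot_span a -> cot_span b -> cot_span (a * b).
Proof.
move=> [c hc] [c' hc']; exists (fun i => p b * c i + p a * c' i).
rewrite -/(lin _) linD !linZ rmorphM -scalerA -mulr_algl /=.
have -> : a * b - (p a)%:A * (p b)%:A - ((p b)%:A * lin c + (p a)%:A * lin c') =
    (a - (p a)%:A) * (b - (p b)%:A)
    + ((p b)%:A * (a - (p a)%:A - lin c) + (p a)%:A * (b - (p b)%:A - lin c')) by ring.
by apply: sqD; [exact: sq_shift | apply: sqD; apply: sqM].
Qed.

Lemma cot_spanX a k : cot_span a -> cot_span (a ^+ k).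
Proof.
move=> ha; elim: k => [|k IH]; first by rewrite expr0 -[1]scale1r; apply: cot_spanC.
by rewrite exprS; apply: cot_spanM.
Qed.

(** The class of [s * a - p a * s] is [p s] times that of [a]. *)
Lemma cot_span_div s a : p s != 0 -> cot_span s -> cot_span (s * a) -> cot_span a.
Proof.
move=> ps [c hc] [c' hc']; exists (fun i => (p s)^-1 * (c' i + (- p a) * c i)).
rewrite -/(lin _) linZ linD linZ.
have u : (p s)^-1%:A * (p s)%:A = 1 :> A.
  by rewrite mulr_algl scalerA mulVf // scale1r.
have N : (- p a)%:A = - (p a)%:A :> A by rewrite scaleNr.
have M : (p (s * a))%:A = (p s)%:A * (p a)%:A :> A.
  by rewrite rmorphM -scalerA -mulr_algl.
rewrite M in hc'; rewrite N.
have -> : a - (p a)%:A - (p s)^-1%:A * (lin c' + - (p a)%:A * lin c) =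
  (p s)^-1%:A * ((s * a - (p s)%:A * (p a)%:A - lin c')
    - (p a)%:A * (s - (p s)%:A - lin c) - (s - (p s)%:A) * (a - (p a)%:A)).
  transitivity ((p s)^-1%:A * (p s)%:A * (a - (p a)%:A)
    - (p s)^-1%:A * (lin c' + - (p a)%:A * lin c)); first by rewrite u mul1r.
  by ring.
apply: sqM; apply: sqD; last by apply: sqN; apply: sq_shift.
by apply: sqD => //; apply: sqN; apply: sqM.
Qed.

(** The class of [a ^+ k.+1] is [k.+1 * p a ^+ k] times that of [a]. *)
Lemma cot_span_root a k : (k.+1)%:R != 0 :> K -> p a != 0 ->
  cot_span (a ^+ k.+1) -> cot_span a.
Proof.
move=> k0 pa [c hc]; pose x := a - (p a)%:A.
have px : p x = 0 by rewrite rmorphB /= point_alg subrr.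
have pw : sq (a ^+ k.+1 - (p a ^+ k.+1)%:A - (k.+1%:R * p a ^+ k)%:A * x).
  elim: k {k0 c hc} => [|k IH].
    by rewrite !expr1 expr0 mulr1 scale1r mul1r -/x subrr; apply: sq0.
  have -> : a ^+ k.+2 - (p a ^+ k.+2)%:A - (k.+2%:R * p a ^+ k.+1)%:A * x =
      a * (a ^+ k.+1 - (p a ^+ k.+1)%:A - (k.+1%:R * p a ^+ k)%:A * x)
      + (k.+1%:R * p a ^+ k)%:A * (x * x).
    rewrite -[k.+2]addn1 natrD mulrDl scalerDl mul1r.
    have E t : (p a * t)%:A = (p a)%:A * t%:A :> A by rewrite mulr_algl scalerA.
    have -> : p a ^+ (k + 1).+1 = p a * p a ^+ k.+1 by rewrite addn1 exprS.
    have -> : k.+1%:R * p a ^+ k.+1 = p a * (k.+1%:R * p a ^+ k) by rewrite exprS mulrCA.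
    by rewrite addn1 [a ^+ k.+2]exprS !E /x; ring.
  by apply: sqD; apply: sqM => //; apply: sq_mul.
set t := k.+1%:R * p a ^+ k in pw.
have t0 : t != 0 by rewrite mulf_neq0 ?expf_neq0.
exists (fun i => t^-1 * c i); rewrite -/(lin _) linZ -/x.
have u : t^-1%:A * t%:A = 1 :> A by rewrite mulr_algl scalerA mulVf // scale1r.
rewrite rmorphXn /= in hc.
have -> : x - t^-1%:A * lin c = t^-1%:A * ((a ^+ k.+1 - (p a ^+ k.+1)%:A - lin c)
    - (a ^+ k.+1 - (p a ^+ k.+1)%:A - t%:A * x)).
  transitivity (t^-1%:A * t%:A * x - t^-1%:A * lin c); first by rewrite u mul1r.
  by ring.
by apply: sqM; apply: sqD => //; apply: sqN.
Qed.

Lemma cot_span_mmap (n : nat) (x : 'I_n -> A) (q : {mpoly K[n]}) :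
  (forall i, (exists2 m, m \in msupp q & m i != 0%N) -> cot_span (x i)) ->
  cot_span (mmap (in_alg A) x q).
Proof.
move=> hx; rewrite /mmap big_seq.
apply: (big_ind cot_span) => [||m mq]; first by rewrite -[0](scale0r 1); apply: cot_spanC.
  exact: cot_spanD.
apply: cot_spanM; first exact: cot_spanC.
apply: (big_ind cot_span) => [||i _]; first by rewrite -[1]scale1r; apply: cot_spanC.
  exact: cot_spanM.
have [->|mi] := eqVneq (m i) 0%N; first by rewrite expr0 -[1]scale1r; apply: cot_spanC.
by apply/cot_spanX/hx; exists m.
Qed.

End Span.

(** [Q] plays the role of a polynomial ring mapping to [A], with [A] contained in a
    localization of its image, and [E] that of a first-order arc through [p]. *)
Section Tangent.
Variables (Q : comNzRingType) (phi : {rmorphism Q -> A}) (E : {rmorphism Q -> {poly K}}).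
Hypothesis E_const : forall c : K, exists2 h, phi h = c%:A & (E h)`_1 = 0.
Hypothesis E0 : forall q, (E q)`_0 = p (phi q).
Hypothesis E_ker : forall q, phi q = 0 -> (E q)`_1 = 0.
Hypothesis phi_loc : forall a, exists q h, p (phi q) != 0 /\ phi q * a = phi h.

(** The graph of the derivation at [p] induced by the first-order arc [E]: the
    quotient rule read on fractions of elements of [Q]. *)
Definition arc_deriv a (s : K) : Prop := exists q h,
  [/\ p (phi q) != 0, phi q * a = phi h & (E h)`_1 = (E q)`_1 * p a + p (phi q) * s].

Lemma coef1M (f g : {poly K}) : (f * g)`_1 = f`_0 * g`_1 + f`_1 * g`_0.
Proof. by rewrite coefM !big_ord_recr big_ord0 /= add0r. Qed.

Lemma arc_derivT a : exists s : K, arc_deriv a s.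
Proof.
have [q [h [q0 e]]] := phi_loc a.
exists (((E h)`_1 - (E q)`_1 * p a) / p (phi q)), q, h; split=> //.
by rewrite [p (phi q) * _]mulrC divfK // addrC subrK.
Qed.

Lemma arc_deriv_uniq a (s t : K) : arc_deriv a s -> arc_deriv a t -> s = t.
Proof.
move=> [q [h [q0 e d]]] [q' [h' [q0' e' d']]].
have : (E (h * q' - h' * q))`_1 = 0.
  by apply: E_ker; rewrite rmorphB !rmorphM /= -e -e'; ring.
rewrite rmorphB !rmorphM /= coefB !coef1M !E0 -e -e' d d' !rmorphM /= => H.
apply: (mulfI q0); apply: (mulfI q0'); apply/eqP; rewrite -subr_eq0 -[X in _ == X]H.
by apply/eqP; ring.
Qed.

Lemma arc_derivD a b (s t : K) : arc_deriv a s -> arc_deriv b t -> arc_deriv (a + b) (s + t).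
Proof.
move=> [q [h [q0 e d]]] [q' [h' [q0' e' d']]]; exists (q * q'), (h * q' + h' * q).
split; first by rewrite !rmorphM mulf_neq0.
  by rewrite rmorphD !rmorphM /= -e -e'; ring.
rewrite rmorphD !rmorphM /= coefD !coef1M !E0 -e -e' d d' !rmorphM rmorphD /=.
by ring.
Qed.

Lemma arc_derivM a b (s t : K) : arc_deriv a s -> arc_deriv b t ->
  arc_deriv (a * b) (p a * t + p b * s).
Proof.
move=> [q [h [q0 e d]]] [q' [h' [q0' e' d']]]; exists (q * q'), (h * h').
split; first by rewrite !rmorphM mulf_neq0.
  by rewrite !rmorphM /= -e -e'; ring.
rewrite !rmorphM /= !coef1M !E0 -e -e' d d' !rmorphM /=.
by ring.
Qed.

Lemma arc_deriv_phi h : arc_deriv (phi h) (E h)`_1.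
Proof.
exists 1, h; rewrite !rmorph1 mul1r oner_eq0; split=> //.
by rewrite coef1 mul0r add0r mul1r.
Qed.

Lemma arc_derivC c : arc_deriv c%:A 0.
Proof. by have [h <- <-] := E_const c; apply: arc_deriv_phi. Qed.

Lemma arc_derivZ c a (s : K) : arc_deriv a s -> arc_deriv (c *: a) (c * s).
Proof.
move/(arc_derivM (arc_derivC c)); rewrite mulr_algl point_alg mulr0 addr0.
by [].
Qed.

Lemma arc_deriv_sum d (f : 'I_d -> A) (s : 'I_d -> K) :
  (forall i, arc_deriv (f i) (s i)) -> arc_deriv (\sum_i f i) (\sum_i s i).
Proof.
move=> fs; apply: (big_rec2 arc_deriv) => [|i t a _ h]; last exact: arc_derivD.
by rewrite -(scale0r 1); apply: arc_derivC.
Qed.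

Lemma arc_deriv_sq a : sq a -> arc_deriv a 0.
Proof.
move=> [m [u [v [hu hv ->]]]].
have -> : 0 = \sum_(i < m) 0 :> K by rewrite big1.
apply: arc_deriv_sum => i; have [s hs] := arc_derivT (u i); have [t ht] := arc_derivT (v i).
by have := arc_derivM hs ht; rewrite hu hv !mul0r addr0.
Qed.

(** The derivation along an arc where only [e j] varies reads off [c j]. *)
Lemma arc_deriv_indep d (e : 'I_d -> A) (j : 'I_d) (c : 'I_d -> K) :
  (forall i, arc_deriv (e i) (i == j)%:R) -> sq (\sum_i c i *: e i) -> c j = 0.
Proof.
move=> he /arc_deriv_sq h0.
have := arc_deriv_sum (fun i => arc_derivZ (c i) (he i)).
move=> /arc_deriv_uniq/(_ h0) => <-; rewrite (bigD1 j) //= eqxx mulr1 big1 ?addr0 //.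
by move=> i /negPf ->; rewrite mulr0.
Qed.

End Tangent.

Lemma cotangent_dimP d (x : 'I_d -> A) :
    (forall a, cot_span (fun i => x i - (p (x i))%:A) a) ->
    (forall c : 'I_d -> K, sq (\sum_i c i *: (x i - (p (x i))%:A)) -> forall j, c j = 0) ->
  cotangent_dim p d.
Proof.
move=> sp ind; exists (fun i => x i - (p (x i))%:A); split=> //.
  by move=> i; rewrite /in_max_ideal rmorphB /= point_alg subrr.
move=> a pa; have [c] := sp a; rewrite pa scale0r subr0 => hc; exists c.
rewrite (eq_bigr (fun i => (c i)%:A * (x i - (p (x i))%:A))) // => i _.
by rewrite mulr_algl.
Qed.

End Cotangent.

(** * The exchange hypersurface *)

Section ExchangeHypersurface.
Variables (K L : fieldType) (iota : {rmorphism K -> L}) (n : nat).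
Hypothesis nz2 : 2%:R != 0 :> K.
Variables (z : 'I_n -> L) (v : 'I_n -> int) (i : 'I_n).
Hypotheses (iz : indep iota z) (vi : v i = 0).

Local Notation ev p := (mmap iota z p).

Definition exch_eq : {poly {mpoly K[n]}} := ('X_i)%:P * 'X - (bpoly K v)%:P.

(** Division with remainder by the exchange relation never stops early: after
    clearing denominators, the leading coefficient of [H] times a power of the
    exchange polynomial is divisible by [z i], which is coprime to that
    polynomial. *)
Lemma exch_eq_dvd H :
  (map_poly (mmap iota z) H).[mutc z i v i] = 0 -> exists G, H = exch_eq * G.
Proof.
have zi := indep_neq0 iz i; set y := mutc z i v i.
have zy : z i * y = ev (bpoly K v) by rewrite /y mutc_at mulVKf // ev_bpoly.
have [N] := ubnP (size H); elim: N H => // N IH H HN Hy.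
have [->|H0] := eqVneq H 0; first by exists 0; rewrite mulr0.
case D : (size H) => [|d]; first by move/eqP: D; rewrite size_poly_eq0 (negPf H0).
have E : \sum_(j < d.+1) H`_j * bpoly K v ^+ j * 'X_i ^+ (d - j) = 0.
  apply: iz; rewrite rmorph_sum /= -[RHS](mulr0 (z i ^+ d)) -[in RHS]Hy.
  rewrite (@horner_coef_wide _ d.+1) ?mulr_sumr; last first.
    by rewrite -D size_poly.
  apply: eq_bigr => j _; have jd : (j <= d)%N by rewrite -ltnS.
  rewrite coef_map !rmorphM !rmorphXn /= evXU -zy exprMn.
  have -> : z i ^+ d = z i ^+ (d - j) * z i ^+ j by rewrite -exprD subnK.
  by ring.
move: E; rewrite big_ord_recr /= subnn mulr1 => E.
have E' : ('X_i : {mpoly K[n]}) ^+ 1 *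
    (- \sum_(j < d) H`_j * bpoly K v ^+ j * 'X_i ^+ (d - j).-1) = bpoly K v ^+ d * H`_d.
  apply/eqP; rewrite mulrN mulr_sumr eq_sym -addr_eq0.
  rewrite [bpoly K v ^+ d * _]mulrC addrC -[X in _ == X]E.
  apply/eqP; congr (_ + _); apply: eq_bigr => j _.
  have -> : (d - j = (d - j).-1.+1)%N by rewrite prednK // subn_gt0.
  by rewrite expr1 /= [in RHS]exprS; ring.
have [||h Hd] := mpolyX_coprime _ _ E'.
- by rewrite expf_neq0 // bpoly_neq0.
- by move=> m; apply: msupp_bpolyX.
rewrite expr1 in Hd.
case: d D E E' Hd => [|d] D E E' Hd.
  have : H`_0 != 0 by have := H0; rewrite -lead_coef_eq0 /lead_coef D.
  by move: E; rewrite big_ord0 add0r expr0 mulr1 => ->; rewrite eqxx.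
have [||G HG] := IH (H - exch_eq * (h%:P * 'X^d)).
- rewrite ltnS in HN; apply: leq_trans HN; rewrite D ltnS; apply/leq_sizeP => j dj.
  have -> : exch_eq * (h%:P * 'X^d) = ('X_i * h)%:P * 'X^(d.+1) - (bpoly K v * h)%:P * 'X^d.
    by rewrite /exch_eq !polyCM exprS; ring.
  rewrite !coefB !coefCM !coefXn (gtn_eqF dj) mulr0 subr0.
  move: dj; rewrite leq_eqVlt => /orP[/eqP<-|dj]; first by rewrite eqxx mulr1 Hd subrr.
  by rewrite (gtn_eqF dj) mulr0 subr0 nth_default // D.
- rewrite rmorphB rmorphM hornerD hornerN hornerM Hy sub0r /exch_eq.
  rewrite rmorphB rmorphM /= !map_polyC map_polyX !hornerE /= evXU zy.
  by rewrite subrr mul0r oppr0.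
by exists (h%:P * 'X^d + G); rewrite mulrDr -HG addrC subrK.
Qed.

End ExchangeHypersurface.

(** * First-order arcs in affine space *)

Section Arcs.
Variables (K : fieldType) (n : nat).

Lemma rmorph_mmap (S S' : comNzRingType) (psi : {rmorphism S -> S'})
    (f : K -> S) (f' : K -> S') (h : 'I_n -> S) (h' : 'I_n -> S') q :
    (forall c, psi (f c) = f' c) -> (forall j, psi (h j) = h' j) ->
  psi (mmap f h q) = mmap f' h' q.
Proof.
move=> ff hh; rewrite /mmap rmorph_sum; apply: eq_bigr => m _.
rewrite rmorphM ff; congr (_ * _); rewrite /mmap1 rmorph_prod.
by apply: eq_bigr => j _; rewrite rmorphXn hh.
Qed.

(** The first-order arc through [a] with velocity [s]. *)
Definition arc_of (a s : 'I_n -> K) : {rmorphism {mpoly K[n]} -> {poly K}} :=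
  mmap (@polyC K) (fun j => (a j)%:P + s j *: 'X).

Lemma arc_ofC a s c : arc_of a s c%:MP = c%:P.
Proof. exact: mmapC. Qed.

Lemma arc_ofU a s j : arc_of a s 'X_j = (a j)%:P + s j *: 'X.
Proof. by rewrite [LHS]mmapX mmap1U. Qed.

Lemma arc_of0 a s q : (arc_of a s q)`_0 = mmap idfun a q.
Proof.
rewrite -horner_coef0; apply: (rmorph_mmap (psi := horner_eval 0)) => [t|i].
  exact: hornerC.
transitivity ((a i)%:P + s i *: 'X).[0] => //.
by rewrite !hornerE.
Qed.

(** The [k]-th variable occurs in exactly one of the two exchange monomials. *)
Lemma bpoly_split (v : 'I_n -> int) k : v k != 0 ->
  exists m1 m2 b, [/\ bpoly K v = 'X_[m1] * 'X_k ^+ b.+1 + 'X_[m2],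
    m1 k = 0%N, m2 k = 0%N & forall j, v j = 0 -> m1 j = 0%N].
Proof.
move=> vk; rewrite /bpoly.
have [lt|gt|] := ltgtP (v k) 0; last by move/eqP; rewrite (negPf vk).
  exists (mnm_off k (mneg v)), (mpos v), (`|v k|%N).-1.
  rewrite prednK ?absz_gt0 // mnm_offE; split=> // [||j vj].
  - rewrite addrC (mpolyX_off K k (mneg v)) mnmE.
    by congr (_ * _ ^+ _ + _); lia.
  - by rewrite mnmE; lia.
  - by rewrite !mnmE vj; case: ifP.
exists (mnm_off k (mpos v)), (mneg v), (`|v k|%N).-1.
rewrite prednK ?absz_gt0 // mnm_offE; split=> // [||j vj].
- rewrite (mpolyX_off K k (mpos v)) mnmE.
  by congr (_ * _ ^+ _ + _); lia.
- by rewrite mnmE; lia.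
- by rewrite !mnmE vj; case: ifP.
Qed.

Lemma arc_of_agree a s s' (m : 'X_{1..n}) : (forall j, m j != 0%N -> s j = s' j) ->
  arc_of a s 'X_[m] = arc_of a s' 'X_[m].
Proof.
move=> ss; rewrite [LHS]mmapX [RHS]mmapX; apply: eq_bigr => j _.
by have [->|/ss->] := eqVneq (m j) 0%N.
Qed.

Lemma coef_linX (a s : K) b :
  ((a%:P + s *: 'X) ^+ b.+1)`_0 = a ^+ b.+1 /\
  ((a%:P + s *: 'X) ^+ b.+1)`_1 = b.+1%:R * a ^+ b * s.
Proof.
have c0 : (a%:P + s *: 'X)`_0 = a by rewrite coefD coefC coefZ coefX mulr0 addr0.
have c1 : (a%:P + s *: 'X)`_1 = s by rewrite coefD coefC coefZ coefX mulr1 add0r.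
elim: b => [|b [IH0 IH1]]; first by rewrite !expr1 expr0 c0 c1 mulr1 mulr1n mul1r.
rewrite exprS coef1M coef0M IH0 IH1 c0 c1; split; first by rewrite -exprS.
by rewrite -[b.+2]addn1 natrD exprS; ring.
Qed.

Definition evalY (S : comNzRingType) (f : {rmorphism {mpoly K[n]} -> S}) (y : S) :
  {rmorphism {poly {mpoly K[n]}} -> S} := horner_eval y \o map_poly f.

Lemma evalYE (S : comNzRingType) (f : {rmorphism {mpoly K[n]} -> S}) y H :
  evalY f y H = (map_poly f H).[y].
Proof. by []. Qed.

Lemma evalYC (S : comNzRingType) (f : {rmorphism {mpoly K[n]} -> S}) y q :
  evalY f y q%:P = f q.
Proof. by rewrite evalYE map_polyC hornerC. Qed.

Lemma evalY_MXaddC (S : comNzRingType) (f : {rmorphism {mpoly K[n]} -> S}) y H q :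
  evalY f y (H * 'X + q%:P) = evalY f y H * y + f q.
Proof. by rewrite !evalYE rmorphD rmorphM /= map_polyX map_polyC !hornerE. Qed.

Lemma evalYX (S : comNzRingType) (f : {rmorphism {mpoly K[n]} -> S}) y :
  evalY f y 'X = y.
Proof. by rewrite evalYE map_polyX hornerX. Qed.

Lemma evalY_exch_eq (S : comNzRingType) (f : {rmorphism {mpoly K[n]} -> S}) y v i :
  evalY f y (exch_eq K v i) = f 'X_i * y - f (bpoly K v).
Proof. by rewrite evalYE rmorphB rmorphM /= map_polyX !map_polyC !hornerE. Qed.

End Arcs.

(** * Points of the cluster algebra *)

Section Points.
Variables (K : fieldType) (n : nat) (B : 'M[int]_n).
Hypothesis char0 : forall k, (k.+1)%:R != 0 :> K.
Hypotheses (sB : skew_symmetric B) (ndB : nondeg B).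

Local Notation A := (cluster_algebra K B).

Lemma reached_in_algebra w j : cluster (reached_seed K B w) j \in in_cluster_algebra B.
Proof. by apply/asboolP => S _; apply; exists w, j. Qed.

Definition cvar j : A := ClusterAlgebra (reached_in_algebra [::] j).

Definition cnew j : A := ClusterAlgebra (reached_in_algebra [:: j] j).

Lemma valM (a b : A) : val (a * b) = val a * val b.
Proof. exact: rmorphM. Qed.

Lemma val_cvar j : val (cvar j) = ratfun_var K j.
Proof. by []. Qed.

Lemma val_cnew j : val (cnew j) = mutc (@ratfun_var K n) j (B j) j.
Proof. by []. Qed.

Definition ev : {rmorphism {mpoly K[n]} -> A} := mmap (in_alg A) cvar.

Lemma evC c : ev c%:MP = c%:A.
Proof. exact: mmapC. Qed.

Lemma evU j : ev 'X_j = cvar j.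
Proof. by rewrite [LHS]mmapX mmap1U. Qed.

Lemma valC c : val (c%:A : A) = cst K n c.
Proof. by rewrite linearZ. Qed.

Lemma val_ev q : val (ev q) = mmap (cst K n) (@ratfun_var K n) q.
Proof. by apply: rmorph_mmap => // c; apply: valC. Qed.

Let nz2 : 2%:R != 0 :> K := char0 1.

Let iz : indep (cst K n) (@ratfun_var K n) := @indep_var K n.

Lemma exchange_relation j : cvar j * cnew j = ev (bpoly K (B j)).
Proof.
apply: val_inj; rewrite val_ev ev_bpoly valM val_cvar val_cnew.
by rewrite mutc_at mulVKf // (indep_neq0 iz j).
Qed.

Lemma ev_inj q : ev q = 0 -> q = 0.
Proof. by move/(congr1 val); rewrite val_ev => /iz. Qed.

Variable p : point A.

Let pD (a b : A) : p (a + b) = p a + p b.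
Proof. exact: rmorphD. Qed.

Let pM (a b : A) : p (a * b) = p a * p b.
Proof. exact: rmorphM. Qed.

Lemma p_ev q : p (ev q) = mmap idfun (fun j => p (cvar j)) q.
Proof. by apply: rmorph_mmap => // c; apply: point_alg. Qed.

Lemma p_evX m : p (ev 'X_[m]) = \prod_j p (cvar j) ^+ m j.
Proof. by rewrite p_ev mmapX. Qed.

Section SmoothChart.
Variables (i k : 'I_n).
Hypothesis (p_off : forall j, j != i -> p (cvar j) != 0).
Hypotheses (ki : k != i) (Bik : B i k != 0).

Let Bii : B i i = 0 := skew_diag sB i.

Let p_off_evX (m : 'X_{1..n}) : m i = 0%N -> p (ev 'X_[m]) != 0.
Proof.
move=> mi; rewrite p_evX; apply/prodf_neq0 => j _.
by have [->|ji] := eqVneq j i; [rewrite mi oner_eq0 | rewrite expf_neq0 // p_off].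
Qed.

Definition cadj j : A := if j == i then cnew i else cvar j.

Lemma two_tori_algebra (a : A) : exists (m : 'X_{1..n}) (d c : {mpoly K[n]}),
  m i = 0%N /\ ev 'X_[m] * a = ev d + mmap (in_alg A) cadj c.
Proof.
have [l1 l2] := cluster_algebra_upper_bound nz2 a sB ndB.
have [m [d [c [mi E]]]] := two_tori (v := B i) nz2 iz Bii l1 (l2 i).
exists m, d, c; split=> //; apply: val_inj; rewrite valM val_ev E.
have valD (u w : A) : val (u + w) = val u + val w by exact: rmorphD.
rewrite valD val_ev; congr (_ + _); apply/esym; apply: rmorph_mmap => [t|j].
  exact: valC.
by rewrite /cadj /mutc; case: (j == i) => //; apply: etrans (val_cnew i) _; rewrite mutc_at.
Qed.

(** Coordinates on the tangent space: the new variable takes the place of the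
    [k]-th variable, whose differential the exchange relation determines. *)
Let w j : A := if j == k then cnew i else cvar j.

Let span a := cot_span p (fun j => w j - (p (w j))%:A) a.

Let span_w j : span (w j).
Proof. exact: (cot_span_gen (j := j)). Qed.

Let span_off j : j != k -> span (cvar j).
Proof. by move=> /negPf jk; have := span_w j; rewrite /w jk. Qed.

Let span_new : span (cnew i).
Proof. by have := span_w k; rewrite /w eqxx. Qed.

Let span_evX (m : 'X_{1..n}) : m k = 0%N -> span (ev 'X_[m]).
Proof.
move=> mk; apply: cot_span_mmap => j [u /mem_msuppXP <- mj]; apply: span_off.
by apply: contraNneq mj => ->; rewrite mk.
Qed.

Let spanN a : span a -> span (- a).
Proof.
move=> sa; rewrite -mulN1r; apply: cot_spanM sa.
by rewrite -scaleN1r; apply: cot_spanC.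
Qed.

(** Near [p] the exchange relation determines a power of the [k]-th variable in
    terms of the other coordinates. *)
Let span_k : span (cvar k).
Proof.
have [m1 [m2 [b [Eb m1k m2k m1i]]]] := bpoly_split K Bik.
apply: (cot_span_root (k := b)) => //; first exact: p_off.
apply: (cot_span_div (s := ev 'X_[m1])); [|exact: span_evX|].
  by apply: p_off_evX; apply: m1i.
have -> : ev 'X_[m1] * cvar k ^+ b.+1 = cvar i * cnew i - ev 'X_[m2].
  by rewrite exchange_relation Eb rmorphD rmorphM rmorphXn /= evU addrK.
apply: cot_spanD; last by apply: spanN; apply: span_evX.
by apply: cot_spanM span_new; apply: span_off; rewrite eq_sym.
Qed.

Let span_cvar j : span (cvar j).
Proof. by have [->|/span_off] := eqVneq j k. Qed.

Let span_all a : span a.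
Proof.
have [m [d [c [mi E]]]] := two_tori_algebra a.
apply: (cot_span_div (s := ev 'X_[m])); first exact: p_off_evX.
  by apply: cot_span_mmap => j _; apply: span_cvar.
rewrite E; apply: cot_spanD; apply: cot_span_mmap => j _; first exact: span_cvar.
by rewrite /cadj; case: ifP => _; [apply: span_new | apply: span_cvar].
Qed.

Local Notation phi := (evalY ev (cnew i)).

Let phi_ker H : phi H = 0 -> exists G, H = exch_eq K (B i) i * G.
Proof.
move=> H0; apply: (exch_eq_dvd nz2 iz Bii); rewrite -val_cnew.
have val_horner q :
    (map_poly (val : {rmorphism A -> ratfun K n}) q).[val (cnew i)] = val q.[cnew i].
  exact: horner_map.
transitivity (val (phi H)); last by rewrite H0.
rewrite evalYE -val_horner; congr (_.[_]).
rewrite -map_poly_comp; apply: eq_map_poly => q.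
by rewrite -val_ev.
Qed.

Let phi_loc a : exists q h, p (phi q) != 0 /\ phi q * a = phi h.
Proof.
have [m [d [c [mi E]]]] := two_tori_algebra a.
pose Hc : {poly {mpoly K[n]}} := mmap (polyC \o @mpolyC n K)
  (fun j => if j == i then 'X else ('X_j)%:P) c.
exists ('X_[m])%:P, (d%:P + Hc); rewrite rmorphD !evalYC; split; first exact: p_off_evX.
rewrite E; congr (_ + _); apply/esym; apply: rmorph_mmap => [t|j].
  exact: etrans (evalYC _ _ _) (evC _).
by rewrite /cadj; case: ifP => _; [exact: evalYX | exact: etrans (evalYC _ _ _) (evU _)].
Qed.

Section Arc.
Variable j : 'I_n.

Let a0 j := p (cvar j).

(** The velocity [g] of the [k]-th variable remains to be chosen, so that the arc
    stays on the exchange hypersurface to first order. *)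
Let arc (g : K) := arc_of a0 (fun l => if l == k then g else (l == j)%:R).
Let ups : {poly K} := (p (cnew i))%:P + (k == j)%:R *: 'X.
Local Notation E g := (evalY (arc g) ups).

Let E0 g H : (E g H)`_0 = p (phi H).
Proof.
elim/poly_ind: H => [|H c IH]; first by rewrite !rmorph0 coef0.
rewrite !evalY_MXaddC pD pM coefD coef0M IH arc_of0 p_ev.
by rewrite coefD coefC coefZ coefX mulr0 addr0.
Qed.

(** The velocity [g] of [x_k] enters linearly, with a coefficient [D] that is the
    derivative of an exchange monomial with respect to [x_k]. *)
Let exch_eq_velocity : exists g, (E g (exch_eq K (B i) i))`_1 = 0.
Proof.
have [m1 [m2 [b [Eb m1k m2k m1i]]]] := bpoly_split K Bik.
have agree g (m : 'X_{1..n}) : m k = 0%N -> arc g 'X_[m] = arc 0 'X_[m].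
  move=> mk; apply: arc_of_agree => l ml; case: eqP => // lk.
  by move: ml; rewrite lk mk.
pose N := p (ev 'X_[m1]); have N0 : N != 0 by apply: p_off_evX; apply: m1i.
pose D := N * (b.+1%:R * a0 k ^+ b).
have D0 : D != 0 by rewrite !mulf_neq0 ?expf_neq0 ?p_off.
pose T := (arc 0 'X_i * ups)`_1 - (arc 0 'X_[m1])`_1 * a0 k ^+ b.+1 - (arc 0 'X_[m2])`_1.
have arcU g : arc g 'X_k = (a0 k)%:P + g *: 'X by rewrite /arc arc_ofU eqxx.
exists (T / D).
rewrite evalY_exch_eq Eb rmorphD rmorphM rmorphXn /= arcU !agree //.
  rewrite coefB coefD [X in _ - (X + _)]coef1M arc_of0 -p_ev -/N.
  have [-> ->] := coef_linX (a0 k) (T / D) b.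
  have -> : N * (b.+1%:R * a0 k ^+ b * (T / D)) = T.
    by rewrite mulrA -/D mulrC divfK.
  by rewrite /T; ring.
by rewrite mnm1E eq_sym (negPf ki).
Qed.

Lemma w_independent (c : 'I_n -> K) :
  in_max_ideal_sq p (\sum_l c l *: (w l - (p (w l))%:A)) -> c j = 0.
Proof.
move=> sqc; have [g Eg] := exch_eq_velocity.
apply: (arc_deriv_indep (phi := phi) (E := E g) _ (E0 g) _ phi_loc _ sqc).
- by move=> t; exists (t%:MP)%:P; rewrite ?evalYC ?evC ?arc_ofC ?coefC.
- move=> H /phi_ker[G ->]; rewrite (rmorphM (E g)) coef1M Eg mul0r addr0 E0.
  have -> : phi (exch_eq K (B i) i) = 0.
    by rewrite evalY_exch_eq evU exchange_relation subrr.
  by rewrite rmorph0 mul0r.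
move=> l; pose h : {poly {mpoly K[n]}} := if l == k then 'X else ('X_l)%:P.
have phih : phi h = w l by rewrite /h /w; case: ifP => _; rewrite ?evalYX // evalYC evU.
have Eh : (E g h)`_1 = (l == j)%:R.
  rewrite /h; have [->|lk] := eqVneq l k.
    by rewrite evalYX coefD coefC coefZ coefX add0r mulr1.
  by rewrite evalYC arc_ofU (negPf lk) coefD coefC coefZ coefX add0r mulr1.
have := arc_deriv_phi p phi (E g) (h - ((p (w l))%:MP)%:P).
rewrite (rmorphB phi) (rmorphB (E g)) coefB Eh phih !evalYC evC arc_ofC coefC subr0.
by [].
Qed.

End Arc.

(** Where at most [x_i] vanishes among the initial variables, the variety is
    the hypersurface defined by the exchange relation for [x_i]; this equation is
    smooth along some [x_k], because one of its two monomials involves [x_k] and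
    does not vanish. *)
Lemma cotangent_chart : cotangent_dim p n.
Proof.
apply: (@cotangent_dimP _ _ p n w); first exact: span_all.
by move=> c sqc j; apply: w_independent sqc.
Qed.

End SmoothChart.

(** If two variables vanished, look at the first one, [x_i]: of the two
    monomials of its exchange relation, the one in the [x_j] with [j < i] would
    be nonzero and the other one zero. *)
Lemma vanish_at_most_one (i0 : 'I_n) :
  (forall i j : 'I_n, (i < j)%N -> 0 < B i j) ->
  exists i, forall j, j != i -> p (cvar j) != 0.
Proof.
move=> B_pos; have [/existsP[i1 pi1]|] := boolP [exists j, p (cvar j) == 0]; last first.
  by rewrite negb_exists => /forallP nz; exists i0 => j _.
have [i /eqP pi0 i_min] :=
  @arg_minnP _ i1 (fun j => p (cvar j) == 0) (fun j : 'I_n => j : nat) pi1.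
exists i => j ji; apply/negP => pj0.
have ij : (i < j)%N by rewrite ltn_neqAle i_min // andbT val_eqE eq_sym.
have neg_neq0 : p (ev 'X_[mneg (B i)]) != 0.
  rewrite p_evX; apply/prodf_neq0 => l _; rewrite mnmE.
  have [il|li] := leqP i l; last first.
    by rewrite expf_neq0 //; apply: contraTneq li => /eqP/i_min; rewrite -leqNgt.
  have -> : `|Num.min (B i l) 0|%N = 0%N; last by rewrite oner_eq0.
  move: il; rewrite leq_eqVlt => /orP[/eqP/val_inj <-|/B_pos]; last by lia.
  by rewrite (skew_diag sB).
have pos_eq0 : p (ev 'X_[mpos (B i)]) = 0.
  rewrite p_evX (bigD1 j) //= (eqP pj0) mnmE expr0n.
  have := B_pos _ _ ij; case: eqP => [|_ _]; last by rewrite mul0r.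
  by lia.
have := congr1 p (exchange_relation i); rewrite pM pi0 mul0r rmorphD pD pos_eq0 add0r.
by move/esym/eqP; rewrite (negPf neg_neq0).
Qed.

Lemma cotangent_cluster (B_pos : forall i j : 'I_n, (i < j)%N -> 0 < B i j) :
  n != 1%N -> cotangent_dim p n.
Proof.
move=> n1; case: (posnP n) => [n0|n_gt0].
  (* There are no variables, so every element is constant. *)
  apply: (cotangent_dimP (x := cvar)) => [a|c _ [j jn]]; last first.
    by have := jn; rewrite [X in (_ < X)%N -> _]n0.
  have [[m [q E]] _] := cluster_algebra_upper_bound nz2 a sB ndB.
  have -> : a = (q@_0)%:A; last exact: cot_spanC.
  apply: val_inj; rewrite valC -[LHS]mul1r -(rmorph1 (mmap (cst K n) (@ratfun_var K n))).
  have -> : 1 = 'X_[m] :> {mpoly K[n]}.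
    rewrite (_ : m = 0%MM) ?mpolyX0 //; apply/mnmP => j.
    by have := ltn_ord j; rewrite [X in (_ < X)%N -> _]n0.
  by rewrite E (nvar0_mpolyC_eq q n0) mmapC mcoeffC eqxx mulr1.
have n_gt1 : (1 < n)%N by rewrite ltn_neqAle eq_sym n1.
have [i p_off] := vanish_at_most_one (Ordinal n_gt0) B_pos.
have [k ki] : exists k : 'I_n, k != i.
  have [i_0|i_n0] := eqVneq (i : nat) 0%N.
    by exists (Ordinal n_gt1); rewrite -val_eqE /= i_0.
  by exists (Ordinal (ltnW n_gt1)); rewrite -val_eqE /= eq_sym.
apply: (cotangent_chart p_off ki).
have [ik|ik|/val_inj ik] := ltngtP (i : nat) k.
- by rewrite gt_eqF // B_pos.
- by rewrite (skewE sB) oppr_eq0 gt_eqF // B_pos.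
- by rewrite ik eqxx in ki.
Qed.

End Points.

(** * Transcendence degree *)

Section TranscendenceDegree.
Variables (K L : fieldType) (iota : {rmorphism K -> L}) (n e : nat).
Variables (x : 'I_n -> L) (y : 'I_e -> L).

Let deg : 'I_n -> int := fun=> 1.

Let wt_deg (m : 'X_{1..n}) j : (m j)%:Z <= wt deg m.
Proof.
by rewrite /wt (bigD1 j) //= natz lerDl sumr_ge0.
Qed.

Let wt_below_exp (d : int) (p : {mpoly K[n]}) k :
  wt_below deg d p -> wt_below deg (d * k%:Z) (p ^+ k).
Proof.
move=> dp; elim: k => [|k IH].
  by rewrite mulr0 expr0 -mpolyC1; apply: wt_belowC.
by rewrite exprS -addn1 PoszD mulrDr mulr1 addrC; apply: wt_belowM.
Qed.

(** By counting: the monomials in [y] with exponents below [N] number [N ^ e] and,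
    after denominators are cleared, lie in the span of at most [(C * N) ^ n]
    monomials in [x], for a constant [C]; the first number is larger for large [N]. *)
Lemma alg_dependent : (n < e)%N ->
    (forall j, exists p q, mmap iota x q != 0 /\ mmap iota x q * y j = mmap iota x p) ->
  exists2 P : {mpoly K[e]}, P != 0 & mmap iota y P = 0.
Proof.
move=> ne /fin_all_exists[p0 /fin_all_exists[q0 pq]].
pose q := \prod_j q0 j; pose p j := p0 j * \prod_(l | l != j) q0 l.
have q_neq0 : mmap iota x q != 0.
  by rewrite rmorph_prod; apply/prodf_neq0 => j _; case: (pq j).
have qy j : mmap iota x q * y j = mmap iota x (p j).
  rewrite /q (bigD1 j) //= !rmorphM /=; have [_ <-] := pq j.
  by ring.
have [D0 [qD pD]] : exists D : nat, wt_below deg D q /\ forall j, wt_below deg D (p j).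
  have [d dq] := wt_below_exists deg q.
  have /fin_all_exists[f fp] j := wt_below_exists deg (p j).
  exists (`|d| + \sum_j `|f j|)%N; split=> [|j].
    by apply: wt_belowW dq; rewrite PoszD; lia.
  by apply: wt_belowW (fp j); rewrite (bigD1 j) //= !PoszD; lia.
pose C := (e * D0).+1; pose N := (C ^ n).+1; pose W := (e * N * D0).+1.
pose G (a : {ffun 'I_e -> 'I_N}) := \prod_j (p j ^+ a j * q ^+ (N - a j)).
have GE a : mmap iota x (G a) = mmap iota x q ^+ (e * N) * \prod_j y j ^+ a j.
  have -> : mmap iota x q ^+ (e * N) = \prod_(j < e) mmap iota x q ^+ N.
    by rewrite prodr_const card_ord mulnC exprM.
  rewrite rmorph_prod /= -big_split /=.
  apply: eq_bigr => j _; rewrite rmorphM !rmorphXn /= -qy exprMn.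
  have aN : (a j <= N)%N by apply: ltnW.
  have -> : mmap iota x q ^+ N = mmap iota x q ^+ a j * mmap iota x q ^+ (N - a j).
    by rewrite -exprD subnKC.
  by ring.
have Gdeg a (m : 'X_{1..n}) j : m \in msupp (G a) -> (m j < W)%N.
  have : wt_below deg (\sum_(j < e) (D0 * N)%:Z) (G a).
    apply: (big_rec2 (wt_below deg)) => [|l g d _ dg].
      by rewrite -mpolyC1; apply: wt_belowC.
    apply: wt_belowM dg.
    have -> : (D0 * N)%:Z = D0%:Z * (a l)%:Z + D0%:Z * (N - a l)%:Z.
      by rewrite -!PoszM -PoszD -mulnDr subnKC // ltnW.
    by apply: wt_belowM; apply: wt_below_exp.
  rewrite sumr_const card_ord => dG /dG wm; have := le_trans (wt_deg m j) wm.
  by rewrite /W; lia.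
pose row := {ffun 'I_e -> 'I_N}; pose col := {ffun 'I_n -> 'I_W}.
pose mon (c : col) : 'X_{1..n} := [multinom c i : nat | i < n].
pose M : 'M[K]_(#|{: row}|, #|{: col}|) :=
  \matrix_(r, c) (G (enum_val r))@_(mon (enum_val c)).
have rc : (#|{: col}| < #|{: row}|)%N.
  rewrite !card_ffun !card_ord.
  have WCN : (W <= C * N)%N by rewrite /W /C; nia.
  apply: (@leq_ltn_trans ((C * N) ^ n)).
    by elim: {1 2}n => // k IH; rewrite !expnS leq_mul.
  apply: (@leq_trans (N ^ n.+1)); last by rewrite leq_pexp2l.
  by rewrite expnMn expnSr mulnC ltn_pmul2l // expn_gt0.
have [v v0 vM] : exists2 v : 'rV_(#|{: row}|), v != 0 & v *m M = 0.
  have : kermx M != 0.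
    rewrite kermx_eq0 /row_free; apply/eqP => rM.
    by have := rank_leq_col M; rewrite rM leqNgt rc.
  by case/rowV0Pn => v /sub_kermxP vM v0; exists v.
pose mone (a : row) : 'X_{1..e} := [multinom a i : nat | i < e].
have mone_inj : injective mone.
  move=> a b /mnmP ab; apply/ffunP => j; apply: val_inj.
  by have := ab j; rewrite !mnmE.
exists (\sum_r v 0 r *: 'X_[mone (enum_val r)]).
  have [r vr] := rV0Pn _ v0.
  apply: contraNneq vr => /(congr1 (mcoeff (mone (enum_val r)))).
  rewrite raddf_sum /= (bigD1 r) //= big1 => [|s sr].
    by rewrite addr0 mcoeffZ mcoeffX eqxx mulr1 mcoeff0 => ->.
  rewrite mcoeffZ mcoeffX (inj_eq mone_inj) (inj_eq enum_val_inj) (negPf sr).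
  by rewrite mulr0.
apply: (mulfI (expf_neq0 (e * N) q_neq0)); rewrite mulr0.
transitivity (mmap iota x (\sum_r v 0 r *: G (enum_val r))).
  rewrite !rmorph_sum mulr_sumr; apply: eq_bigr => r _ /=.
  rewrite !mmapZ GE mmapX /mmap1 mulrCA; congr (_ * (_ * _)).
  by apply: eq_bigr => j _; rewrite mnmE.
suff -> : \sum_r v 0 r *: G (enum_val r) = 0 by rewrite rmorph0.
apply/mpolyP => m; rewrite mcoeff0 raddf_sum /=.
have [mW|mW] := boolP [forall j, m j < W]%N; last first.
  rewrite big1 // => r _; rewrite mcoeffZ memN_msupp_eq0 ?mulr0 //.
  by apply: contra mW => mG; apply/forallP => j; apply: Gdeg mG.
pose c : col := [ffun j => Ordinal (forallP mW j)].
have -> : m = mon c by apply/mnmP => j; rewrite mnmE ffunE.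
have /matrixP/(_ 0 (enum_rank c)) := vM; rewrite !mxE => vc; rewrite -[RHS]vc.
by apply: eq_bigr => r _; rewrite mcoeffZ mxE enum_rankK.
Qed.

End TranscendenceDegree.

(** * Smoothness *)

Section Smooth.
Variables (K : fieldType) (n : nat) (B : 'M[int]_n).
Hypothesis char0 : forall k, (k.+1)%:R != 0 :> K.
Hypotheses (sB : skew_symmetric B) (ndB : nondeg B).

Lemma cluster_algebra_dim : variety_dim (cluster_algebra K B) n.
Proof.
split; first by exists (@cvar K n B) => P; apply: ev_inj.
move=> e z z_indep; rewrite leqNgt; apply/negP => ne.
have [|P /eqP P0 zP] := alg_dependent (iota := cst K n) (x := @ratfun_var K n)
    (y := fun j => val (z j)) ne.
  move=> j; have [[m [q E]] _] := cluster_algebra_upper_bound (char0 1) (z j) sB ndB.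
  exists q, 'X_[m]; split=> //; apply: evX_neq0; apply: indep_neq0; exact: indep_var.
apply: P0; apply: z_indep; apply: val_inj; rewrite -[RHS]zP.
by apply: rmorph_mmap => // c; apply: valC.
Qed.

End Smooth.

Lemma nondeg_unitmx n (B : 'M[int]_n) : ratmx B \in unitmx -> nondeg B.
Proof.
move=> uB c Hc i; suff /rowP/(_ i) : \row_j c j = 0 by rewrite !mxE.
rewrite -[LHS](mulmxK uB) (_ : _ *m ratmx B = 0) ?mul0mx //.
apply/rowP => j; rewrite !mxE -[RHS](Hc j).
by apply: eq_bigr => l _; rewrite !mxE.
Qed.

Theorem corollary4p2 (R : realType) (n k : nat) (B : 'M[int]_n)
  (n_even : n = (2 * k)%N)
  (B_skew : skew_symmetric B)
  (B_inv : ratmx B \in unitmx)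
  (B_pos : forall i j : 'I_n, (i < j)%N -> 0 < B i j)
  (B_acyclic : acyclic_cluster_algebra R[i] B)
  (B_sum : forall i : 'I_n,
     \sum_(j < n) invmx (ratmx B) i j
       * (Num.max (B i j) 0 + Num.min (B i j) 0)%:~R != 0) :
  smooth (cluster_algebra R[i] B).
Proof.
have char0 m : (m.+1)%:R != 0 :> R[i] by rewrite pnatr_eq0.
have ndB := nondeg_unitmx B_inv.
exists n; first exact: cluster_algebra_dim.
move=> p; apply: cotangent_cluster => //.
by rewrite n_even; apply/eqP => /(congr1 odd); rewrite oddM.
Qed.
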